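(* Let $b\ge2$ be an integer. For each $m\ge1$ and $N=b^m$ let $P_N=\{x_0,\ldots,x_{N-1}\}\subseteq[0,1)^2$ be a $(0,m,2)$-net in base $b$, and let $Z_N=\Phi(P_N)$ be the $N$-point configuration on $\mathbb{S}^2$ consisting of the points $\Phi(x_0),\ldots,\Phi(x_{N-1})$. Then, as $N=b^m\to\infty$: (i) $\lim_{N\to\infty}D(Z_N;\mathbb{S}^2,\mathcal{F}_K)=0$ for every fixed $K>0$ (where $\mathcal{F}_K$ is the family of $K$-regular test sets); (ii) $\lim_{N\to\infty}D(Z_N;\mathbb{S}^2,\mathcal{C})=0$ (where $\mathcal{C}$ is the family of all spherical caps); (iii) $\lim_{N\to\infty}D(Z_N;\mathbb{S}^2,\Omega)=0$ (where $\Omega$ is the family of spherical rectangles). Consequently, the sequence $\{Z_N\}$ is asymptotically uniformly distributed on $\mathbb{S}^2$.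
   Context: $\mathbb{S}^2$ is the unit sphere in $\mathbb{R}^3$ and $\sigma_2$ is the normalized surface area measure on it ($\sigma_2(\mathbb{S}^2)=1$). Nets: a point set $P\subseteq[0,1)^2$ consisting of $b^m$ points is a $(0,m,2)$-net in base $b$ if for all nonnegative integers $d_1,d_2$ with $d_1+d_2=m$ and all integers $0\le a_i<b^{d_i}$ ($i=1,2$), the interval $\prod_{i=1}^2\left[\frac{a_i}{b^{d_i}},\frac{a_i+1}{b^{d_i}}\right)$ contains exactly one point of $P$. Lifting map: $\Phi:[0,1]^2\to\mathbb{S}^2$, $\Phi(x_1,x_2)=\left(2\cos(2\pi x_1)\sqrt{x_2-x_2^2},\;2\sin(2\pi x_1)\sqrt{x_2-x_2^2},\;1-2x_2\right)$. Discrepancy: for a family $\mathcal{A}$ of $\sigma_2$-measurable subsets of $\mathbb{S}^2$ and an $N$-point configuration $Z_N$, $D(Z_N;\mathbb{S}^2,\mathcal{A})=\sup_{A\in\mathcal{A}}\left|\frac{|Z_N\cap A|}{N}-\sigma_2(A)\right|$. Families of test sets. Spherical caps: $\mathcal{C}=\{C(z,t):z\in\mathbb{S}^2,\,-1\le t\le1\}$ with $C(z,t)=\{y\in\mathbb{S}^2:\langle y,z\rangle\le t\}$. Spherical rectangles: $\Omega=\{\Omega_{\theta_1,\theta_2,\phi_1,\phi_2}:0\le\theta_1<\theta_2\le1,\ 0\le\phi_1<\phi_2\le1\}$ with $\Omega_{\theta_1,\theta_2,\phi_1,\phi_2}=\{(\cos(2\pi\theta)\sin(\pi\phi),\sin(2\pi\theta)\sin(\pi\phi),\cos(\pi\phi)):\theta_1\le\theta<\theta_2,\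 \phi_1\le\phi<\phi_2\}$. $K$-regular sets: fix once and for all a threshold $\delta_0>0$ (arbitrary, but the same for all test sets). A $\sigma_2$-measurable set $A\subseteq\mathbb{S}^2$ is $K$-regular if for every $0<\delta\le\delta_0$, $$\sigma_2\left(\{z\in\mathbb{S}^2:\operatorname{dist}(A,z)\le\delta,\ \operatorname{dist}(\mathbb{S}^2\setminus A,z)\le\delta\}\right)\le K\delta,$$ where $\operatorname{dist}(A,z)=\inf_{z'\in A}\|z-z'\|$ with the Euclidean norm (and $\operatorname{dist}(\emptyset,z)=\infty$). $\mathcal{F}_K$ is the family of all $K$-regular sets. The sequence $\{Z_N\}$ (indexed by $N=b^m$) is asymptotically uniformly distributed on $\mathbb{S}^2$ if $\lim_{N\to\infty}\frac1N\sum_{z\in Z_N}f(z)=\int_{\mathbb{S}^2}f\,\mathrm{d}\sigma_2$ for every continuous $f:\mathbb{S}^2\to\mathbb{R}$. *)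

(* Defs.v *)
From HB Require Import structures.
From mathcomp Require Import all_boot all_order all_algebra.
From mathcomp Require Import all_classical all_reals all_analysis.
From mathcomp Require Import measurable_realfun ring.

Set Implicit Arguments.
Unset Strict Implicit.
Unset Printing Implicit Defensive.

Import Order.TTheory GRing.Theory Num.Theory.
Import numFieldNormedType.Exports.

Local Open Scope classical_set_scope.
Local Open Scope ring_scope.

Definition dot (R : realType) (u v : R * R * R) : R :=
  u.1.1 * v.1.1 + u.1.2 * v.1.2 + u.2 * v.2.

Definition cross (R : realType) (u v : R * R * R) : R * R * R :=
  (u.1.2 * v.2 - u.2 * v.1.2,
   u.2 * v.1.1 - u.1.1 * v.2,
   u.1.1 * v.1.2 - u.1.2 * v.1.1).

(* The library norm on a product is the maximum norm. *)
Definition enorm (R : realType) (u : R * R * R) : R := Num.sqrt (dot u u).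

Definition sphere (R : realType) : set (R * R * R) := [set u | enorm u = 1].
Arguments sphere {R}.

Definition spherical_coord (R : realType) (u : R * R) : R * R * R :=
  (cos (2 * pi * u.1) * sin (pi * u.2),
   sin (2 * pi * u.1) * sin (pi * u.2),
   cos (pi * u.2)).

Definition unit_square (R : realType) : set (R * R) := `[0, 1] `*` `[0, 1].
Arguments unit_square {R}.

Definition partial1 (R : realType) (X : R * R -> R * R * R) (u : R * R) :
    R * R * R :=
  (derive1 (fun t => (X (t, u.2)).1.1) u.1,
   derive1 (fun t => (X (t, u.2)).1.2) u.1,
   derive1 (fun t => (X (t, u.2)).2) u.1).

Definition partial2 (R : realType) (X : R * R -> R * R * R) (u : R * R) :
    R * R * R :=
  (derive1 (fun t => (X (u.1, t)).1.1) u.2,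
   derive1 (fun t => (X (u.1, t)).1.2) u.2,
   derive1 (fun t => (X (u.1, t)).2) u.2).

Definition area_element (R : realType) (u : R * R) : R :=
  enorm (cross (partial1 (@spherical_coord R) u)
               (partial2 (@spherical_coord R) u)).

(* [spherical_coord] maps the unit square onto the sphere and is injective
   off the boundary, a null set, so the surface area of a Borel set is the
   integral of the area element over its preimage. *)
Definition surface_area (R : realType) (A : set (R * R * R)) : \bar R :=
  (\int[lebesgue_measure \x lebesgue_measure]_(u in
     unit_square `&` @spherical_coord R @^-1` A) (area_element u)%:E)%E.

Lemma area_elementE (R : realType) (u : R * R) :
  area_element u = 2 * pi ^+ 2 * `|sin (pi * u.2)|.
Proof.
have dc (a t : R) : is_derive t 1 (fun x => cos (a * x)) (- (a * sin (a * t))).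
  have h : is_derive t (1:R) ( *%R a) a.
    by apply: is_derive_eq; rewrite /GRing.scale/= mulr1.
  have k : is_derive (a * t) (1:R) cos (- sin (a * t)) by exact: is_derive_cos.
  apply: is_derive_eq (is_derive1_comp k h) _.
  by rewrite mulNr mulrC.
have ds (a t : R) : is_derive t 1 (fun x => sin (a * x)) (a * cos (a * t)).
  have h : is_derive t (1:R) ( *%R a) a.
    by apply: is_derive_eq; rewrite /GRing.scale/= mulr1.
  have k : is_derive (a * t) (1:R) sin (cos (a * t)) by exact: is_derive_sin.
  apply: is_derive_eq (is_derive1_comp k h) _.
  by rewrite mulrC.
have dM (f : R -> R) (c d t : R) : is_derive t 1 f d ->
    derive1 (fun x => f x * c) t = d * c.
  move=> h; rewrite derive1E; apply: derive_val.
  rewrite (_ : (fun x => _) = c *: f); last by apply/funext => x /=; rewrite mulrC.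
  by apply: is_derive_eq; rewrite /GRing.scale/= mulrC.
have dM' (f : R -> R) (c d t : R) : is_derive t 1 f d ->
    derive1 (fun x => c * f x) t = c * d.
  move=> h; rewrite mulrC -(dM _ _ _ _ h); congr (derive1 _ _).
  by apply/funext => x; rewrite mulrC.
rewrite /area_element /partial1 /partial2 /spherical_coord /=.
rewrite !(dM _ _ _ _ (dc _ _)) !(dM _ _ _ _ (ds _ _)).
rewrite !(dM' _ _ _ _ (ds _ _)).
rewrite derive1_cst derive1E (@derive_val _ _ _ _ _ _ _ (dc _ _)).
rewrite /enorm /dot /cross /=.
set s := sin (pi * _); set c := cos (pi * _).
set S := sin _; set C := cos _.
rewrite (_ : _ + _ = (2 * pi ^+ 2 * `|s|) ^+ 2).
  by rewrite sqrtr_sqr ger0_norm// mulr_ge0// mulr_ge0// exprn_ge0// pi_ge0.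
have SC : S ^+ 2 = 1 - C ^+ 2 by rewrite /S /C sin2cos2.
have sc : c ^+ 2 = 1 - s ^+ 2 by rewrite /s /c cos2sin2.
rewrite !exprMn real_normK ?num_real//.
ring: SC sc.
Qed.

Lemma measurable_area_element (R : realType) :
  measurable_fun setT (@area_element R).
Proof.
rewrite (_ : @area_element R = fun u => 2 * pi ^+ 2 * `|sin (pi * u.2)|).
  apply: measurable_funM => //; apply: measurableT_comp => //.
  apply: (measurableT_comp (f := @sin R)).
    by apply: continuous_measurable_fun; exact: continuous_sin.
  by apply: measurable_funM => //; exact: measurable_snd.
by apply/funext => u; exact: area_elementE.
Qed.

Lemma measurable_spherical_coord (R : realType) :
  measurable_fun setT (@spherical_coord R).
Proof.
have mc (g : R * R -> R) : measurable_fun setT g ->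
    measurable_fun setT (fun u => cos (g u)).
  apply: (measurableT_comp (f := @cos R)).
  by apply: continuous_measurable_fun; exact: continuous_cos.
have ms (g : R * R -> R) : measurable_fun setT g ->
    measurable_fun setT (fun u => sin (g u)).
  apply: (measurableT_comp (f := @sin R)).
  by apply: continuous_measurable_fun; exact: continuous_sin.
have m1 (c : R) : measurable_fun setT (fun u : R * R => c * u.1).
  by apply: measurable_funM => //; exact: measurable_fst.
have m2 (c : R) : measurable_fun setT (fun u : R * R => c * u.2).
  by apply: measurable_funM => //; exact: measurable_snd.
apply: measurable_fun_pair; last exact: mc (m2 _).
by apply: measurable_fun_pair; apply: measurable_funM;
  [exact: mc (m1 _)|exact: ms (m2 _)|exact: ms (m1 _)|exact: ms (m2 _)].
Qed.

Lemma surface_area0 (R : realType) : surface_area (@set0 (R * R * R)) = 0%E.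
Proof. by rewrite /surface_area preimage_set0 setI0 integral_set0. Qed.

Lemma surface_area_ge0 (R : realType) (A : set (R * R * R)) :
  (0 <= surface_area A)%E.
Proof. by apply: integral_ge0 => u _; rewrite lee_fin sqrtr_ge0. Qed.

Lemma surface_area_sigma_additive (R : realType) :
  semi_sigma_additive (@surface_area R).
Proof.
move=> F mF tF mUF.
have mP A : measurable A -> measurable (unit_square `&` @spherical_coord R @^-1` A).
  move=> mA; apply: measurableI.
    by apply: measurableX; exact: measurable_itv.
  by rewrite -[X in measurable X]setTI; apply: measurable_spherical_coord.
have -> : surface_area (\bigcup_n F n) = (\sum_(i <oo) surface_area (F i))%E.
  rewrite /surface_area preimage_bigcup setI_bigcupr ge0_integral_bigcup//.
  - by move=> k; exact: mP.
  - apply/measurable_EFinP; apply: measurable_funS (@measurable_area_element R) => //.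
  - by move=> u _; rewrite lee_fin sqrtr_ge0.
  - apply/trivIsetP => i j _ _ ij; rewrite setIACA setIid -preimage_setI.
    by move/trivIsetP : tF => /(_ i j Logic.I Logic.I ij) ->; rewrite preimage_set0 setI0.
by apply: is_cvg_nneseries => n _ _; exact: surface_area_ge0.
Qed.

HB.instance Definition _ (R : realType) := isMeasure.Build _ _ _
  (@surface_area R) (@surface_area0 R) (@surface_area_ge0 R)
  (@surface_area_sigma_additive R).

Lemma inv_surface_area_ge0 (R : realType) :
  0 <= (fine (surface_area (@sphere R)))^-1.
Proof. by rewrite invr_ge0 fine_ge0// surface_area_ge0. Qed.

(* A Borel measure on R^3, concentrated on the sphere. *)
Definition sigma2 (R : realType) (A : set (R * R * R)) : \bar R :=
  ((fine (surface_area (@sphere R)))^-1%:E * surface_area A)%E.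

HB.instance Definition _ (R : realType) := Measure.copy (@sigma2 R)
  (mscale (NngNum (inv_surface_area_ge0 R)) (@surface_area R)).

(* The outer measure generated by [sigma2]: its restriction to its
   Caratheodory-measurable sets is the completion of [sigma2]. *)
Definition sigma2_ext (R : realType) : set (R * R * R) -> \bar R :=
  mu_ext (@sigma2 R).

Definition sigma2_measurable (R : realType) (A : set (R * R * R)) : Prop :=
  A `<=` sphere /\ caratheodory_measurable (@sigma2_ext R) A.

Definition is_net (R : realType) (b m : nat) (x : 'I_(b ^ m) -> R * R) : Prop :=
  [/\ injective x,
      forall i, [/\ 0 <= (x i).1, (x i).1 < 1, 0 <= (x i).2 & (x i).2 < 1] &
      forall d1 d2 a1 a2 : nat, (d1 + d2 = m)%N ->
        (a1 < b ^ d1)%N -> (a2 < b ^ d2)%N ->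
        exists! i : 'I_(b ^ m),
          [/\ a1%:R / b%:R ^+ d1 <= (x i).1,
              (x i).1 < a1.+1%:R / b%:R ^+ d1,
              a2%:R / b%:R ^+ d2 <= (x i).2 &
              (x i).2 < a2.+1%:R / b%:R ^+ d2]].

Definition lift_map (R : realType) (x : R * R) : R * R * R :=
  (2 * cos (2 * pi * x.1) * Num.sqrt (x.2 - x.2 ^+ 2),
   2 * sin (2 * pi * x.1) * Num.sqrt (x.2 - x.2 ^+ 2),
   1 - 2 * x.2).

(* Configurations are indexed families; a point is counted as often as it is
   listed. *)
Definition discrepancy (R : realType) (N : nat) (Z : 'I_N -> R * R * R)
    (F : set (set (R * R * R))) : \bar R :=
  ereal_sup [set `|(#|[pred i | Z i \in A]|%:R / N%:R)%:E - sigma2_ext A|%E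
            | A in F].

Definition cap (R : realType) (z : R * R * R) (t : R) : set (R * R * R) :=
  [set y | sphere y /\ dot y z <= t].

Definition caps (R : realType) : set (set (R * R * R)) :=
  [set A | exists z t, [/\ sphere z, -1 <= t, t <= 1 & A = cap z t]].

Definition rectangle (R : realType) (t1 t2 p1 p2 : R) : set (R * R * R) :=
  [set spherical_coord u | u in
    [set u | [/\ t1 <= u.1, u.1 < t2, p1 <= u.2 & u.2 < p2]]].

Definition rectangles (R : realType) : set (set (R * R * R)) :=
  [set A | exists t1 t2 p1 p2,
    [/\ [/\ 0 <= t1, t1 < t2 & t2 <= 1],
        [/\ 0 <= p1, p1 < p2 & p2 <= 1] &
        A = rectangle t1 t2 p1 p2]].

Definition dist (R : realType) (A : set (R * R * R)) (z : R * R * R) : \bar R :=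
  ereal_inf [set (enorm (z - z'))%:E | z' in A].

Definition regular_sets (R : realType) (delta0 K : R) :
    set (set (R * R * R)) :=
  [set A | sigma2_measurable A /\
    forall delta : R, 0 < delta -> delta <= delta0 ->
      (sigma2_ext [set z | [/\ sphere z, dist A z <= delta%:E &
                               dist (sphere `\` A) z <= delta%:E]]
       <= (K * delta)%:E)%E].

Definition asymptotically_uniform (R : realType) (N : nat -> nat)
    (Z : forall m, 'I_(N m) -> R * R * R) : Prop :=
  forall f : R * R * R -> R, {within sphere, continuous f} ->
    (\sum_(i < N m) f (Z m i)) / (N m)%:R @[m --> \oo] -->
      \int[@sigma2 R]_(z in sphere) f z.

(* Main.v *)
From HB Require Import structures.
Require Import Defs.
From mathcomp Require Import all_boot all_order all_algebra.
From mathcomp Require Import all_classical all_reals all_analysis.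
From mathcomp Require Import measurable_realfun ring lra zify.

(** The lifting map [Phi] is area preserving (Archimedes): [sigma2] is the
    image under [Phi] of Lebesgue measure on [[0, 1)^2].  For [N = b ^ m] cut
    the square into the [k * l] congruent cells with [k = b ^ (m / 2)] and
    [l = b ^ (m - m / 2)]; by the net property each cell has area [1 / N] and
    contains exactly one point.  Hence the local discrepancy of a test set [A]
    is at most [1 / N] times the number of boundary cells, those whose image
    meets both [A] and its complement.  As the images of the cells shrink
    uniformly, the boundary cells

    - of a [K]-regular set have their images in the [e]-neighbourhood of the
      boundary, whose measure is at most [K e];
    - of a rectangle lie in two columns and three rows;
    - of a cap [<y, z> <= t] have a corner where [<Phi(u), z> - t] is small.
      On a horizontal line this is a trigonometric polynomial of degree one,
      which cannot be small at three mutually distant points unless its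
      non-constant coefficients are small; that exception occurs only near the
      poles or for [z] near the axis, where the cap is almost a polar cap.

    Equidistribution follows from uniform continuity on the cells. *)

Set Implicit Arguments.
Unset Strict Implicit.
Unset Printing Implicit Defensive.

Import Order.TTheory GRing.Theory Num.Theory.
Import numFieldNormedType.Exports.

Local Open Scope classical_set_scope.
Local Open Scope ring_scope.

(** * The area-preserving change of the polar coordinate *)

Section density_image.
Context d d' (T : measurableType d) (U : measurableType d') (R : realType).
Variables (mu : {measure set T -> \bar R}) (D : set T) (h : T -> U) (w : T -> R).
Hypotheses (mD : measurable D) (mh : measurable_fun setT h).
Hypotheses (mw : measurable_fun setT w) (w0 : forall t, 0 <= w t).

(** Taken as a measure in [B], so that a change of variables can be proved by uniqueness of
    measures. *)
Definition density_image (B : set U) : \bar R :=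
  (\int[mu]_(t in D `&` h @^-1` B) (w t)%:E)%E.

Let density_image0 : density_image set0 = 0%E.
Proof. by rewrite /density_image preimage_set0 setI0 integral_set0. Qed.

Let density_image_ge0 B : (0 <= density_image B)%E.
Proof. by apply: integral_ge0 => t _; rewrite lee_fin. Qed.

Let density_image_sigma_additive : semi_sigma_additive density_image.
Proof.
move=> F mF tF mUF.
have mP n : measurable (D `&` h @^-1` F n).
  by apply: measurableI => //; rewrite -[X in measurable X]setTI; exact: mh.
rewrite /density_image preimage_bigcup setI_bigcupr ge0_integral_bigcup//.
- by apply: is_cvg_nneseries => n _ _; exact: density_image_ge0.
- by apply/measurable_EFinP; exact: measurable_funS mw.
- by move=> t _; rewrite lee_fin.
- apply/trivIsetP => i j _ _ ij; rewrite setIACA setIid -preimage_setI.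
  by move/trivIsetP : tF => /(_ i j Logic.I Logic.I ij) ->;
    rewrite preimage_set0 setI0.
Qed.

HB.instance Definition _ := isMeasure.Build _ _ _ density_image
  density_image0 density_image_ge0 density_image_sigma_additive.

Definition density_image_measure : {measure set U -> \bar R} := density_image.

End density_image.

Section colatitude.
Variable R : realType.
Notation leb := (@lebesgue_measure R).

(** The solution [x] of [1 - 2 * x = cos (pi * p)]: the second argument of [lift_map] for the point
    at colatitude [pi * p]. *)
Definition height (p : R) : R := (1 - cos (pi * p)) / 2.

Lemma is_derive_height (p : R) : is_derive p 1 height (pi / 2 * sin (pi * p)).
Proof.
have h : is_derive p (1:R) ( *%R pi) pi.
  by apply: is_derive_eq; rewrite /GRing.scale/= mulr1.
have k : is_derive (pi * p) (1:R) cos (- sin (pi * p)) by exact: is_derive_cos.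
have := is_derive1_comp k h.
rewrite /height => hc.
rewrite (_ : (fun _ => _) = (2^-1 : R) \*: (cst 1 - (cos \o *%R pi))); last first.
  by apply/funext => x /=; rewrite !fctE /GRing.scale/= mulrC.
apply: is_derive_eq.
rewrite /GRing.scale/=.
by rewrite sub0r; field.
Qed.

Lemma height0 : height 0 = 0.
Proof. by rewrite /height mulr0 cos0 subrr mul0r. Qed.

Lemma height1 : height 1 = 1.
Proof. by rewrite /height mulr1 cospi; field. Qed.

Lemma sin_pi_ge0 (p : R) : 0 <= p <= 1 -> 0 <= sin (pi * p).
Proof.
move=> /andP[p0 p1]; apply: sin_ge0_pi; rewrite mulr_ge0 ?pi_ge0//=.
by rewrite ger_pMr// pi_gt0.
Qed.

Lemma pi_itv (p : R) : 0 <= p <= 1 -> pi * p \in `[0, pi].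
Proof.
by move=> /andP[p0 p1]; rewrite in_itv/= mulr_ge0 ?pi_ge0//= ger_pMr// pi_gt0.
Qed.

Lemma height_lt (p q : R) : 0 <= p <= 1 -> 0 <= q <= 1 ->
  (height p < height q) = (p < q).
Proof.
move=> p01 q01; rewrite /height ltr_pM2r// ltrD2l ltrN2.
by rewrite (ltr_cos (pi_itv p01) (pi_itv q01)) ltr_pM2l ?pi_gt0.
Qed.

Lemma height_le (p q : R) : 0 <= p <= 1 -> 0 <= q <= 1 ->
  (height p <= height q) = (p <= q).
Proof. by move=> p01 q01; rewrite !leNgt height_lt. Qed.

Lemma height01 (p : R) : 0 <= height p <= 1.
Proof.
have := cos_le1 (pi * p); have := cos_geN1 (pi * p).
by rewrite /height; move=> *; apply/andP; split; lra.
Qed.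

Definition colat (c : R) : R := acos (1 - 2 * c) / pi.

Lemma colat01 (c : R) : 0 <= c <= 1 -> 0 <= colat c <= 1.
Proof.
move=> /andP[c0 c1]; rewrite /colat.
have h : -1 <= 1 - 2 * c <= 1 by apply/andP; split; lra.
by rewrite divr_ge0 ?acos_ge0 ?pi_ge0//= ler_pdivrMr ?pi_gt0// mul1r acos_lepi.
Qed.

Lemma colatK (c : R) : 0 <= c <= 1 -> height (colat c) = c.
Proof.
move=> /andP[c0 c1]; rewrite /height /colat [pi * _]mulrC divfK ?gt_eqF ?pi_gt0//.
by rewrite acosK; [field|rewrite in_itv/=; apply/andP; split; lra].
Qed.

Lemma continuous_height : continuous height.
Proof.
move=> p; apply/differentiable_continuous/derivable1_diffP.
by have [d _] := is_derive_height p; exact: d.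
Qed.

Lemma measurable_height : measurable_fun setT height.
Proof. by apply: continuous_measurable_fun; exact: continuous_height. Qed.

(** The derivative of [height] on [[0, 1]]; the absolute value makes it nonnegative on the whole
    line, as a density has to be, and matches [area_elementE]. *)
Definition height_density (p : R) : R := pi / 2 * `|sin (pi * p)|.

Lemma height_density_ge0 (p : R) : 0 <= height_density p.
Proof. by rewrite mulr_ge0// divr_ge0// pi_ge0. Qed.

Lemma continuous_height_density : continuous height_density.
Proof.
move=> p; apply: cvgM; first exact: cvg_cst.
apply: cvg_norm; apply: (@continuous_comp _ _ _ ( *%R pi) sin) => /=.
  exact: mulrl_continuous.
exact: continuous_sin.
Qed.

Lemma integral_height_density (t : R) : 0 <= t <= 1 ->
  (\int[leb]_(p in `[0%R, t]) (height_density p)%:E = (height t)%:E)%E.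
Proof.
move=> /andP[]; rewrite le_eqVlt => /predU1P[<- _|t0 t1].
  by rewrite set_itv1 integral_set1 height0.
rewrite (@continuous_FTC2 _ _ height)//.
- by rewrite height0 sube0.
- by apply: continuous_subspaceT => p; exact: continuous_height_density.
- have dh x : derivable height x 1 by have [d _] := is_derive_height x; exact: d.
  split => //.
  + exact/cvg_at_right_filter/continuous_height.
  + exact/cvg_at_left_filter/continuous_height.
- move=> p; rewrite in_itv/= => /andP[p0 pt].
  rewrite derive1E (@derive_val _ _ _ _ _ _ _ (is_derive_height p)).
  rewrite /height_density ger0_norm// sin_pi_ge0// ltW//= ltW//.
  exact: lt_le_trans t1.
Qed.

(** Substitution of [height]. Both sides are measures in [Y]; by the fundamental theorem of calculus
    they agree on the rays []-oo, c[], which are stable under intersection and generate the Borel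
    sets. *)
Lemma height_density_image (Y : set R) : measurable Y ->
  (\int[leb]_(p in `[0%R, 1%R] `&` height @^-1` Y) (height_density p)%:E =
   leb (`[0%R, 1%R[ `&` Y))%E.
Proof.
move=> mY.
have mw : measurable_fun setT height_density.
  by apply: continuous_measurable_fun; exact: continuous_height_density.
have mI : measurable (`[0%R, 1%R] : set R) by exact: measurable_itv.
have mJ : measurable (`[0%R, 1%R[ : set R) by exact: measurable_itv.
pose m1 : {measure set measurableTypeR R -> \bar R} :=
  @density_image_measure _ _ _ (measurableTypeR R) _ leb _ _ _
    mI measurable_height mw height_density_ge0.
pose m2 : {measure set measurableTypeR R -> \bar R} := mrestr leb mJ.
have -> : leb (`[0%R, 1%R[ `&` Y) = m2 Y by rewrite /m2 /= /mrestr setIC.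
rewrite -[LHS]/(m1 Y).
refine (@measure_unique _ R (measurableTypeR R) (@RGenInftyO.G R)
  (fun n => `]-oo, n%:R[%classic) _ _ _ _ m1 m2 _ _ Y mY).
- exact: RGenInftyO.measurableE.
- move=> _ _ [a ->] [b ->]; exists (Num.min a b).
  by apply/seteqP; split => x /=; rewrite !in_itv/= lt_min => /andP.
- by move=> n; eexists.
- apply/seteqP; split => // x _; exists (Num.truncn `|x|).+1 => //=.
  by rewrite in_itv/= (le_lt_trans (ler_norm x))// truncnS_gt.
- move=> _ [c ->].
  rewrite /m1 /m2 /= /density_image /mrestr.
  (* As [height] takes its values in [[0, 1]], the ray []-oo, c[] has empty preimage for [c <= 0]
     and full preimage for [c > 1]; in between the preimage is [[0, colat c[]. *)
  have [c0|c0] := leP c 0.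
    rewrite [X in (\int[_]_(_ in X) _)%E](_ : _ = set0); last first.
      apply/seteqP; split => // p /=; rewrite !in_itv/= => -[p01].
      by have /andP[h0 _] := height01 p; rewrite ltNge (le_trans c0).
    rewrite [X in leb X](_ : _ = set0) ?measure0 ?integral_set0//.
    apply/seteqP; split => // p /=; rewrite !in_itv/= => -[pc /andP[p0 _]].
    by move: (lt_le_trans pc c0); rewrite ltNge p0.
  have [c1|c1] := ltP 1 c.
    rewrite [X in (\int[_]_(_ in X) _)%E](_ : _ = `[0%R, 1%R]%classic); last first.
      apply/seteqP; split => [p []//|p p01]; split => //=.
      by rewrite in_itv/=; have /andP[_ /le_lt_trans->] := height01 p.
    rewrite integral_height_density ?lexx ?ler01// height1.
    rewrite [X in leb X](_ : _ = `[0%R, 1%R[%classic).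
      by rewrite lebesgue_measure_itv/= lte_fin ltr01 sube0.
    apply/seteqP; split => p /=; rewrite !in_itv/=; first by case.
    by move=> /andP[-> p1]; rewrite p1; split => //; exact: lt_trans c1.
  have c01 : 0 <= c <= 1 by rewrite ltW.
  have t01 := colat01 c01.
  rewrite [X in (\int[_]_(_ in X) _)%E](_ : _ = `[0%R, colat c[%classic); last first.
    apply/seteqP; split => p /=; rewrite !in_itv/=.
      move=> [p01]; rewrite -[X in _ < X](colatK c01) height_lt// => ->.
      by case/andP: p01 => ->.
    move=> /andP[p0 pt].
    have p01 : 0 <= p <= 1.
      by case/andP: t01 => _ t1; rewrite p0/= (le_trans (ltW pt)).
    by split => //; rewrite -[X in _ < X](colatK c01) height_lt.
  rewrite integral_itv_bndo_bndc; last first.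
    by apply/measurable_EFinP; exact: measurable_funTS.
  rewrite integral_height_density// colatK//.
  rewrite [X in leb X](_ : _ = `[0%R, c[%classic).
    by rewrite lebesgue_measure_itv/= lte_fin c0 sube0.
  apply/seteqP; split => p /=; rewrite !in_itv/=.
    by move=> [-> /andP[->]].
  by move=> /andP[-> pc]; split => //=; exact: lt_le_trans c1.
- move=> n; rewrite /m1 /= /density_image.
  apply: (@le_lt_trans _ _ (\int[leb]_(p in `[0%R, 1%R]) (height_density p)%:E)%E).
    apply: ge0_subset_integral => //.
    + apply: measurableI => //; rewrite -[X in measurable X]setTI.
      by apply: measurable_height => //; exact: measurable_itv.
    + by apply/measurable_EFinP; exact: measurable_funTS.
    + by move=> p _; rewrite lee_fin height_density_ge0.
  by rewrite integral_height_density ?lexx ?ler01// ltry.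
Qed.

End colatitude.

(** * The lifting map carries Lebesgue measure on the square to [sigma2] *)

Section lift.
Variable R : realType.
Notation leb := (@lebesgue_measure R).

Definition half_open_square : set (R * R) := `[0, 1[ `*` `[0, 1[.

(** The radicand is [(sin (pi * u.2) / 2) ^+ 2], and on the unit square this sine is nonnegative, so
    the root drops the square without a sign. *)
Lemma lift_map_height (u : R * R) : unit_square u ->
  lift_map (u.1, height u.2) = spherical_coord u.
Proof.
move=> [_]; rewrite /= in_itv/= => u2; rewrite /lift_map /spherical_coord /=.
have -> : height u.2 - height u.2 ^+ 2 = (sin (pi * u.2) / 2) ^+ 2.
  by rewrite [RHS]exprMn sin2cos2 /height; field.
rewrite sqrtr_sqr ger0_norm; last first.
  by rewrite divr_ge0// sin_pi_ge0.
by congr (_, _, _); rewrite /height; field.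
Qed.

Lemma measurable_lift_map : measurable_fun setT (@lift_map R).
Proof.
have mc (g : R -> R) (k : R * R -> R) : continuous g -> measurable_fun setT k ->
    measurable_fun setT (fun u => g (k u)).
  move=> cg mk; apply: (measurableT_comp (f := g)) mk.
  exact: continuous_measurable_fun.
have ms : measurable_fun setT (fun u : R * R => Num.sqrt (u.2 - u.2 ^+ 2)).
  apply: mc; first exact: sqrt_continuous.
  apply: measurable_funB; first exact: measurable_snd.
  by apply: measurable_funX; exact: measurable_snd.
have m1 : measurable_fun setT (fun u : R * R => 2 * pi * u.1).
  by apply: measurable_funM => //; exact: measurable_fst.
apply: measurable_fun_pair.
  apply: measurable_fun_pair; apply: measurable_funM => //;
    apply: measurable_funM => //.
    by apply: mc => //; exact: continuous_cos.
  by apply: mc => //; exact: continuous_sin.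
by apply: measurable_funB => //; apply: measurable_funM.
Qed.

Lemma area_element_height (u : R * R) :
  area_element u = 4 * pi * height_density u.2.
Proof. by rewrite area_elementE /height_density; field. Qed.

(** Archimedes: by Tonelli the area is integrated over the longitude first, and on each meridian
    [height_density_image] turns the colatitude into the height. The constant is the total area of
    the sphere. *)
Lemma surface_areaE (A : set (R * R * R)) : measurable A ->
  (surface_area A =
   (4 * pi)%:E * (leb \x leb) (half_open_square `&` @lift_map R @^-1` A))%E.
Proof.
move=> mA.
set C := @lift_map R @^-1` A.
have mC : measurable C.
  by rewrite -[C]setTI; exact: measurable_lift_map.
have mIo : measurable (`[0%R, 1%R[ : set R) by exact: measurable_itv.
have mI : measurable (`[0%R, 1%R] : set R) by exact: measurable_itv.
pose g (s : R) : \bar R := leb (`[0%R, 1%R[ `&` xsection C s).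
have mg : measurable_fun setT g.
  rewrite (_ : g = leb \o xsection ((setT `*` `[0%R, 1%R[) `&` C)).
    apply: measurable_fun_xsection; apply: measurableI => //.
    exact: measurableX.
  apply/funext => s; rewrite /g /= xsectionI; congr (leb (_ `&` _)).
  by apply/seteqP; split => y; rewrite /xsection/= inE/= => // -[].
have g0 s : (0 <= g s)%E by exact: measure_ge0.
have -> : ((leb \x leb) (half_open_square `&` C) =
    \int[leb]_(s in `[0%R, 1%R[) g s)%E.
  rewrite /product_measure1 [RHS]integral_mkcond; apply: eq_integral => s _.
  rewrite patchE /= xsectionI; case: ifPn => [sI|sI].
    congr (leb (_ `&` _)).
    apply/seteqP; split => y; rewrite /xsection/= inE/=; first by case.
    by move=> yI; split => //=; rewrite inE in sI.
  rewrite (_ : xsection _ _ = set0) ?set0I ?measure0//.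
  apply/seteqP; split => // y; rewrite /xsection/= inE => -[/= sI' _].
  by move/negP: sI; rewrite inE.
(* The added end point is null; the closed interval is the one used in [unit_square]. *)
rewrite integral_itv_bndo_bndc; last exact: measurable_funTS.
rewrite /surface_area integral_mkcond.
have mE : measurable (unit_square `&` @spherical_coord R @^-1` A).
  apply: measurableI; first exact: measurableX.
  by rewrite -[X in measurable X]setTI; exact: measurable_spherical_coord.
rewrite fubini_tonelli1; last 2 first.
- apply/(measurable_restrictT _ _).1 => //.
  by apply/measurable_EFinP; apply: measurable_funTS; exact: measurable_area_element.
- by move=> u; rewrite patchE; case: ifPn => //; rewrite lee_fin sqrtr_ge0.
rewrite -ge0_integralZl//; last 2 first.
- exact: measurable_funTS.
- by rewrite lee_fin mulr_ge0// pi_ge0.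
rewrite [RHS]integral_mkcond; apply: eq_integral => s _.
rewrite /fubini_F patchE; case: ifPn => [|sI].
  rewrite inE/= => sI.
  rewrite /g -height_density_image; last exact: measurable_xsection.
  rewrite -ge0_integralZl//; last 4 first.
  - apply: measurableI => //; rewrite -[X in measurable X]setTI.
    by apply: measurable_height => //; exact: measurable_xsection.
  - apply/measurable_EFinP/measurable_funTS.
    by apply: continuous_measurable_fun; exact: continuous_height_density.
  - by move=> p _; rewrite lee_fin height_density_ge0.
  - by rewrite lee_fin mulr_ge0// pi_ge0.
  rewrite [RHS]integral_mkcond; apply: eq_integral => p _.
  rewrite !patchE area_element_height/= EFinM; congr (if _ then _ else _).
  have := lift_map_height (u := (s, p)).
  rewrite /unit_square /xsection /=; move=> h; apply/idP/idP; rewrite !inE/=.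
    by move=> -[[_ pI]]; rewrite -h// inE/=.
  by move=> -[pI]; rewrite inE /C/= h.
rewrite integral0_eq// => p _; rewrite patchE; case: ifPn => //.
by rewrite inE/= => -[[/= sI' _] _]; move/negP: sI; rewrite inE.
Qed.

Lemma half_open_squareE : (leb \x leb)%E half_open_square = 1%E.
Proof.
rewrite /half_open_square product_measure1E;
  [|exact: measurable_itv|exact: measurable_itv].
by rewrite /= !lebesgue_measure_itv/= lte_fin ltr01 oppr0 adde0 mule1.
Qed.

Lemma lift_map_sphere (u : R * R) : unit_square u -> sphere (lift_map u).
Proof.
move=> [_]; rewrite /= in_itv/= => /andP[u0 u1].
rewrite /sphere /= /enorm /dot /lift_map /=.
set C := cos _; set S := sin _; set s := Num.sqrt (u.2 - _).
have ss : s ^+ 2 = u.2 - u.2 ^+ 2.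
  by rewrite sqr_sqrtr// subr_ge0 expr2 ler_piMr.
have CS : C ^+ 2 = 1 - S ^+ 2 by rewrite cos2sin2.
rewrite (_ : _ + _ = 1) ?sqrtr1//.
ring: ss CS.
Qed.

Lemma measurable_sphere : measurable (@sphere R).
Proof.
have m1 : measurable_fun setT (fun u : R * R * R => u.1.1).
  exact: (measurableT_comp measurable_fst measurable_fst).
have m2 : measurable_fun setT (fun u : R * R * R => u.1.2).
  exact: (measurableT_comp measurable_snd measurable_fst).
have m3 : measurable_fun setT (fun u : R * R * R => u.2).
  exact: measurable_snd.
suff m : measurable_fun setT (@enorm R).
  rewrite (_ : sphere = setT `&` @enorm R @^-1` [set 1]); last by rewrite setTI.
  by apply: m => //; exact: measurable_set1.
apply: (measurableT_comp (f := @Num.sqrt R)).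
  by apply: continuous_measurable_fun; exact: sqrt_continuous.
by apply: measurable_funD; [apply: measurable_funD|]; exact: measurable_funM.
Qed.

Lemma half_open_unit_square : half_open_square `<=` @unit_square R.
Proof.
move=> u [/= u1 u2]; split => /=; rewrite !in_itv/= in u1 u2 *.
  by case/andP: u1 => -> /ltW.
by case/andP: u2 => -> /ltW.
Qed.

(** The whole square is mapped into the sphere, so the sphere has area [4 * pi] and the
    normalization cancels the constant of [surface_areaE]. *)
Lemma sigma2E (A : set (R * R * R)) : measurable A ->
  (sigma2 A = (leb \x leb) (half_open_square `&` @lift_map R @^-1` A))%E.
Proof.
move=> mA; rewrite /sigma2 !surface_areaE//; last exact: measurable_sphere.
rewrite (_ : half_open_square `&` @lift_map R @^-1` sphere = half_open_square).
  rewrite half_open_squareE mule1 /= muleA -EFinM mulVf ?mul1e//.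
  by rewrite mulf_neq0// gt_eqF// pi_gt0.
apply/setIidl => u Hu; exact/lift_map_sphere/half_open_unit_square.
Qed.

End lift.
Arguments half_open_square {R}.

(** * Discrepancy and boundary cells *)

Lemma card_predU_le (T : finType) (P Q : {pred T}) :
  (#|[predU P & Q]| <= #|P| + #|Q|)%N.
Proof. by rewrite -cardUI leq_addr. Qed.

Section cells.
Variables (R : realType) (T : finType) (cell : T -> set (R * R)).
Notation leb := (@lebesgue_measure R).
Hypothesis T_gt0 : (0 < #|T|)%N.
Hypothesis mcell : forall t, measurable (cell t).
Hypothesis cell_sub : forall t, cell t `<=` half_open_square.
Hypothesis cell_inj : forall t t' u, cell t u -> cell t' u -> t = t'.
Hypothesis cellE : forall t, (leb \x leb)%E (cell t) = (#|T|%:R^-1)%:E.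

Lemma measure_cells (S : {pred T}) :
  (leb \x leb)%E (\bigcup_(t in [set` S]) cell t) = (#|S|%:R / #|T|%:R)%:E.
Proof.
have -> : [set` S] = [set` enum S].
  by apply/seteqP; split => t /=; rewrite mem_enum.
rewrite measure_fin_bigcup//; last 2 first.
- by move=> t t' _ _ [u [tu t'u]]; exact: cell_inj tu t'u.
- by move=> t _; exact: mcell.
rewrite -fsbig_seq ?enum_uniq// (eq_bigr (fun=> (#|T|%:R^-1)%:E)); last first.
  by move=> t _; exact: cellE.
by rewrite sumEFin big_const_seq count_predT -cardE iter_addr_0 mulr_natl.
Qed.

(** Every countable Borel cover of [D] pulls back to a cover of [U] of the same total measure, so
    subadditivity bounds the infimum defining the outer measure. No Borel structure of [D]
    enters. *)
Lemma sigma2_ext_ge (U : set (R * R)) (D : set (R * R * R)) :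
  measurable U -> U `<=` half_open_square ->
  (forall u, U u -> D (lift_map u)) ->
  ((leb \x leb) U <= sigma2_ext D)%E.
Proof.
move=> mU UH UD; apply: le_ereal_inf_tmp => _ [F [mF DF] <-].
under eq_eseriesr => n _ do rewrite sigma2E//.
apply: measure_sigma_subadditive => //.
- move=> n; apply: measurableI.
    by apply: measurableX; exact: measurable_itv.
  by rewrite -[X in measurable X]setTI; exact: measurable_lift_map.
- move=> u Uu; have [n _ Fn] := DF _ (UD _ Uu).
  by exists n => //; split => //; exact: UH.
Qed.

Lemma sigma2_ext_cells_ge (S : {pred T}) (D : set (R * R * R)) :
  (forall t u, t \in S -> cell t u -> D (lift_map u)) ->
  ((#|S|%:R / #|T|%:R)%:E <= sigma2_ext D)%E.
Proof.
move=> SD; rewrite -measure_cells; apply: sigma2_ext_ge.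
- by apply: fin_bigcup_measurable => //; exact: finite_finpred.
- by move=> u [t _]; exact: cell_sub.
- by move=> u [t]; exact: SD.
Qed.

Lemma sigma2_ext_sphere : sigma2_ext (@sphere R) = 1%E.
Proof.
rewrite /sigma2_ext measurable_mu_extE; last exact: measurable_sphere.
rewrite /= sigma2E; last exact: measurable_sphere.
rewrite setIidl ?half_open_squareE// => u Hu.
exact/lift_map_sphere/half_open_unit_square.
Qed.

Definition boundary_cells (A : set (R * R * R)) : {pred T} :=
  [pred t | `[< (exists2 u, cell t u & A (lift_map u)) /\
                (exists2 u, cell t u & ~ A (lift_map u)) >]].

(* Inner and outer cells bound the outer measures of [A] and of its complement
   from below; measurability of [A] makes these two sum to 1, which turns the
   second bound into an upper bound for [A]. *)
Lemma count_sub_sigma2_le (x : T -> R * R) (A : set (R * R * R)) :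
  (forall t, cell t (x t)) -> sigma2_measurable A ->
  (`|(#|[pred t | lift_map (x t) \in A]|%:R / #|T|%:R)%:E - sigma2_ext A| <=
   (#|boundary_cells A|%:R / #|T|%:R)%:E)%E.
Proof.
move=> cx [AS cA].
set c := #|_|.
pose inner := [pred t | `[< forall u, cell t u -> A (lift_map u) >]].
pose outer := [pred t | `[< forall u, cell t u -> ~ A (lift_map u) >]].
have N0 : (0 : R) < #|T|%:R by rewrite ltr0n.
have le_inner : ((#|inner|%:R / #|T|%:R)%:E <= sigma2_ext A)%E.
  by apply: sigma2_ext_cells_ge => t u /asboolP; exact.
have le_outer : ((#|outer|%:R / #|T|%:R)%:E <= sigma2_ext (sphere `&` ~` A))%E.
  apply: sigma2_ext_cells_ge => t u /asboolP ot tu; split; last exact: ot.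
  by apply: lift_map_sphere; exact/half_open_unit_square/(cell_sub tu).
(* The Caratheodory condition on [A], tested on the sphere. *)
have sum1 : (sigma2_ext A + sigma2_ext (sphere `&` ~` A) = 1)%E.
  by rewrite -sigma2_ext_sphere [RHS]cA (setIidr AS).
have cover : (#|T| <= #|inner| + #|outer| + #|boundary_cells A|)%N.
  apply: leq_trans (leq_add (card_predU_le _ _) (leqnn _)).
  apply: leq_trans (card_predU_le _ _).
  apply/subset_leq_card/fintype.subsetP => t _; rewrite !inE.
  have [//|/existsNP[v /not_implyP[tv nAv]]] := asboolP.
  have [//|/existsNP[u /not_implyP[tu /contrapT Au]]] := asboolP.
  by apply/asboolP; split; [exists u|exists v].
(* With one sample point per cell, inner cells contribute to [c] and outer cells do not. *)
have le_c : (#|inner| <= c)%N.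
  by apply/subset_leq_card/fintype.subsetP => t /asboolP it; rewrite !inE; exact: it.
have c_le : (c + #|outer| <= #|T|)%N.
  rewrite -cardUI [X in (_ + X)%N]eq_card0 ?addn0 ?max_card// => t.
  apply/negP; rewrite !inE => /andP[/set_mem At /asboolP ot].
  exact: ot At.
(* The sum being 1 and the lower bounds force both outer measures to be finite; what remains is
   linear arithmetic. *)
move: le_inner le_outer sum1.
case: (sigma2_ext A) => [s||]//; case: (sigma2_ext (sphere `&` ~` A)) => [s'||]//.
rewrite !lee_fin !ler_pdivrMr// => lei leo [ss].
move: cover le_c c_le; rewrite -!(ler_nat R) !natrD => cover le_c c_le.
have -> : c%:R / #|T|%:R - s = (c%:R - s * #|T|%:R) / #|T|%:R :> R.
  by rewrite mulrBl mulfK ?gt_eqF.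
rewrite normrM [`|_^-1|]gtr0_norm ?invr_gt0// ler_pM2r ?invr_gt0// ler_norml.
have s's : s' = 1 - s by lra.
move: leo; rewrite s's mulrBl mul1r => leo.
by apply/andP; split; lra.
Qed.

End cells.

(** * Grid cells as elementary intervals of the net *)

Section grid.
Variable R : realType.
Notation leb := (@lebesgue_measure R).

(** For [k = b ^ d1], [l = b ^ d2] and [d1 + d2 = m] these are elementary intervals of the net;
    general [k] and [l] keep the base out of the counting of boundary cells. *)
Definition grid_cell (k l : nat) (t : 'I_k * 'I_l) : set (R * R) :=
  `[t.1%:R / k%:R, t.1.+1%:R / k%:R[ `*` `[t.2%:R / l%:R, t.2.+1%:R / l%:R[.

Lemma measurable_grid_cell (k l : nat) (t : 'I_k * 'I_l) :
  measurable (grid_cell t).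
Proof. by apply: measurableX; exact: measurable_itv. Qed.

Lemma grid_itv_sub (k : nat) (i : 'I_k) (s : R) :
  i%:R / k%:R <= s < i.+1%:R / k%:R -> 0 <= s < 1.
Proof.
move=> /andP[ges lts]; rewrite (le_trans _ ges) ?divr_ge0//=.
rewrite (lt_le_trans lts)// ler_pdivrMr ?mul1r ?ler_nat//.
by rewrite ltr0n (leq_trans _ (ltn_ord i)).
Qed.

Lemma grid_cell_sub (k l : nat) (t : 'I_k * 'I_l) :
  grid_cell t `<=` half_open_square.
Proof.
move=> u [/=]; rewrite !in_itv/= => /grid_itv_sub u1 /grid_itv_sub u2.
by split; rewrite /= in_itv.
Qed.

Lemma grid_itv_le (k i j : nat) (s : R) :
  i%:R / k%:R <= s -> s < j.+1%:R / k%:R -> (i <= j)%N.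
Proof.
move=> ges lts; have := le_lt_trans ges lts.
have [->|k0] := posnP k; first by rewrite invr0 !mulr0 ltxx.
by rewrite ltr_pM2r ?invr_gt0 ?ltr0n// ltr_nat.
Qed.

Lemma grid_cell_inj (k l : nat) (t t' : 'I_k * 'I_l) (u : R * R) :
  grid_cell t u -> grid_cell t' u -> t = t'.
Proof.
move=> [/=]; rewrite !in_itv/= => /andP[i1 i2] /andP[j1 j2].
move=> [/=]; rewrite !in_itv/= => /andP[i1' i2'] /andP[j1' j2'].
rewrite (surjective_pairing t) (surjective_pairing t').
by congr pair; apply/val_inj/eqP; rewrite eqn_leq;
  apply/andP; split; apply: grid_itv_le; eassumption.
Qed.

Lemma grid_cellE (k l : nat) (t : 'I_k * 'I_l) :
  (leb \x leb)%E (grid_cell t) = (#|{: 'I_k * 'I_l}|%:R^-1)%:E.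
Proof.
have itvE (n : nat) (i : 'I_n) :
    leb (`[i%:R / n%:R, i.+1%:R / n%:R[%classic : set R) = (n%:R^-1)%:E.
  have n0 : (0 : R) < n%:R^-1 by rewrite invr_gt0 ltr0n (leq_trans _ (ltn_ord i)).
  rewrite lebesgue_measure_itv/= lte_fin ltr_pM2r// ltr_nat ltnSn -EFinB -mulrBl.
  by rewrite -natrB// subSnn mul1r.
rewrite /grid_cell product_measure1E; [|exact: measurable_itv|exact: measurable_itv].
by rewrite /= !itvE -EFinM card_prod !card_ord natrM invfM.
Qed.

(** Choosing a point in each cell is injective because cells are disjoint, and it is bijective
    because there are as many cells as points. *)
Lemma net_cell_bij (b m d1 d2 : nat) (x : 'I_(b ^ m) -> R * R) :
  (d1 + d2 = m)%N -> is_net x ->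
  exists2 c : 'I_(b ^ d1) * 'I_(b ^ d2) -> 'I_(b ^ m),
    bijective c & forall t, grid_cell t (x (c t)).
Proof.
move=> dm [_ _ net].
have /choice[c cP] (t : 'I_(b ^ d1) * 'I_(b ^ d2)) :
    exists i, grid_cell t (x i).
  have [i [[h1 h2 h3 h4] _]] := net _ _ _ _ dm (ltn_ord t.1) (ltn_ord t.2).
  by exists i; split; rewrite /= in_itv/= !natrX; apply/andP.
exists c => //; apply: inj_card_bij.
  move=> t t' cc; apply: (grid_cell_inj (cP t)); rewrite cc; exact: cP.
by rewrite card_prod !card_ord -expnD dm.
Qed.

Lemma net_local_discrepancy_le (b m d1 d2 : nat) (x : 'I_(b ^ m) -> R * R)
    (A : set (R * R * R)) : (0 < b)%N -> (d1 + d2 = m)%N -> is_net x ->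
  sigma2_measurable A ->
  (`|(#|[pred i | lift_map (x i) \in A]|%:R / (b ^ m)%:R)%:E - sigma2_ext A| <=
   (#|boundary_cells (@grid_cell (b ^ d1) (b ^ d2)) A|%:R / (b ^ m)%:R)%:E)%E.
Proof.
move=> b0 dm netx mA; have [c bc cP] := net_cell_bij dm netx.
have N : #|{: 'I_(b ^ d1) * 'I_(b ^ d2)}| = (b ^ m)%N.
  by rewrite card_prod !card_ord -expnD dm.
have := @count_sub_sigma2_le _ _ (@grid_cell (b ^ d1) (b ^ d2)) _
  (@measurable_grid_cell _ _) (@grid_cell_sub _ _) (@grid_cell_inj _ _)
  (@grid_cellE _ _) (x \o c) A cP mA.
rewrite N expn_gt0 b0 => /(_ isT).
suff -> : #|[pred t | lift_map ((x \o c) t) \in A]| =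
  #|[pred i | lift_map (x i) \in A]| by [].
rewrite -!sum1_card (reindex c) //=; exact: onW_bij.
Qed.

(** Non-emptiness of [F] keeps the supremum nonnegative, the supremum of the empty set being
    [-oo]. *)
Lemma discrepancy_cvg0 (N : nat -> nat) (Z : forall m, 'I_(N m) -> R * R * R)
    (F : set (set (R * R * R))) : F !=set0 ->
  (forall e : R, 0 < e -> \forall m \near \oo, forall A, F A ->
    (`|(#|[pred i | Z m i \in A]|%:R / (N m)%:R)%:E - sigma2_ext A| <= e%:E)%E) ->
  discrepancy (Z m) F @[m --> \oo] --> 0%E.
Proof.
move=> [A0 FA0] small.
have d0 m : (0 <= discrepancy (Z m) F)%E.
  by apply: le_ereal_sup_tmp; eexists; [by exists A0|exact: abse_ge0].
have dle e : 0 < e -> \forall m \near \oo, (discrepancy (Z m) F <= e%:E)%E.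
  move=> e0; near=> m; apply: ge_ereal_sup => _ [A FA <-].
  by move: A FA; near: m; exact: small.
apply/fine_cvgP; split.
  near=> m; rewrite ge0_fin_numE//; apply: (@le_lt_trans _ _ 1%:E); last exact: ltry.
  by near: m; exact: dle.
apply/cvgrPdist_le => e e0; near=> m.
rewrite /= sub0r normrN ger0_norm ?fine_ge0//.
have : (discrepancy (Z m) F <= e%:E)%E by near: m; exact: dle.
by move: (d0 m); case: (discrepancy (Z m) F).
Unshelve. all: by end_near. Qed.

Lemma grid_near (b : nat) (M : nat) : (1 < b)%N ->
  \forall m \near \oo, (M <= b ^ m./2)%N /\ (M <= b ^ (m - m./2))%N.
Proof.
move=> b1; near=> m.
(* Then both halves of [m] are at least [M], and [d < b ^ d]. *)
have Mm : (M.*2 <= m)%N by near: m; exact: nbhs_infty_ge.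
have h d : (M <= d)%N -> (M <= b ^ d)%N.
  by move=> Md; exact: leq_trans Md (ltnW (ltn_expl _ b1)).
by split; apply: h; lia.
Unshelve. all: by end_near. Qed.

(** The common reduction for the three families: it remains to show that the proportion of boundary
    cells tends to 0 uniformly over the family. *)
Lemma net_discrepancy_cvg0 (b : nat) (x : forall m, 'I_(b ^ m) -> R * R)
    (F : set (set (R * R * R))) : (1 < b)%N ->
  (forall m, (1 <= m)%N -> is_net (x m)) -> F !=set0 ->
  F `<=` @sigma2_measurable R ->
  (forall e : R, 0 < e -> exists M : nat, forall k l : nat,
    (M <= k)%N -> (M <= l)%N -> forall A, F A ->
    #|boundary_cells (@grid_cell k l) A|%:R <= e * (k * l)%:R) ->
  discrepancy (fun i => lift_map (x m i)) F @[m --> \oo] --> 0%E.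
Proof.
move=> b1 netx F0 Fm small; apply: (discrepancy_cvg0 (N := expn b)) => // e e0.
have [M HM] := small _ e0.
have := grid_near M b1; apply: filter_app; near=> m => -[Mk Ml] A FA.
have m1 : (1 <= m)%N by near: m; exact: nbhs_infty_ge.
have dm : (m./2 + (m - m./2) = m)%N by lia.
apply: (le_trans (net_local_discrepancy_le _ dm (netx _ m1) (Fm _ FA))).
  exact: ltnW.
have N0 : (0 : R) < (b ^ m)%:R by rewrite ltr0n expn_gt0 (ltnW b1).
have := HM _ _ Mk Ml _ FA; rewrite -expnD dm => H.
by rewrite lee_fin (ler_pdivrMr _ _ N0).
Unshelve. all: by end_near. Qed.

End grid.

(** * Topology of the sphere and of the lifting map *)

(** Compactness in its near-covering form: a property that holds for points near each [x] in [K] and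
    all small [d] holds on all of [K] for small [d]. *)
Lemma compact_uniformly_continuous (R : realType) (T U : pseudoMetricType R)
    (K : set T) (f : T -> U) : compact K -> {within K, continuous f} ->
  forall e : R, 0 < e -> exists2 d : R, 0 < d &
    forall x y, K x -> K y -> ball x d y -> ball (f x) e (f y).
Proof.
move=> /compact_near_coveringP cK /subspace_continuousP cf e e0.
pose P (d : R) x := K x -> forall y, K y -> ball x d y -> ball (f x) e (f y).
have : \forall d \near (0:R)^'+, K `<=` P d.
  apply: (cK _ _ P) => x Kx.
  have e20 : 0 < e / 2 by rewrite divr_gt0.
  have := cf _ Kx _ (nbhsx_ballx (f x) _ e20).
  rewrite nbhs_simpl/= /within/= => /nbhs_ballP[r /= r0 Hr].
  (* Half of the radius is for the moving centre and half for [d], so that both points stay within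
     [r] of [x]. *)
  exists (ball x (r / 2), [set d | d < r / 2]).
    split; first by apply: nbhsx_ballx; rewrite divr_gt0.
    by apply: nbhs_right_lt; rewrite divr_gt0.
  move=> [x' d] /= [xx' dr] Kx' y Ky x'y.
  apply: ball_splitr (Hr x' _ Kx') _.
    by apply: le_ball xx'; rewrite ler_pdivrMr// ler_pMr// ler1n.
  apply: (Hr y _ Ky).
  apply: ball_split xx' _; exact: le_ball (ltW dr) _ x'y.
move=> H.
near (0:R)^'+ => d; exists d; first by [].
have KP : K `<=` P d by near: d; exact: H.
by move=> x y Kx Ky; exact: (KP x Kx Kx y Ky).
Unshelve. all: by end_near. Qed.

Section space.
Variable R : realType.
Notation R3 := (R * R * R)%type.

(** Balls of the maximum norm are products of intervals, hence measurable, and countably many of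
    them, with rational centres and radii [1 / n], form a base of the topology. *)
Lemma open_measurable_space (O : set R3) : open O -> measurable O.
Proof.
move=> oO.
pose box (q : rat * rat * rat * nat) : set R3 :=
  ball (ratr q.1.1.1 : R, ratr q.1.1.2 : R, ratr q.1.2 : R) (q.2.+1%:R^-1).
have mball (a r : R) : measurable (ball a r) by exact: measurable_ball.
have mbox q : measurable (box q).
  rewrite (_ : box q = (ball (ratr q.1.1.1 : R) q.2.+1%:R^-1 `*`
    ball (ratr q.1.1.2 : R) q.2.+1%:R^-1) `*` ball (ratr q.1.2 : R) q.2.+1%:R^-1).
    by apply: measurableX => //; exact: measurableX.
  by apply/seteqP; split => -[[a b] c].
rewrite (_ : O = \bigcup_(q in [set q | box q `<=` O]) box q); last first.
  apply/seteqP; split; last by move=> u [q qO]; exact: qO.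
  move=> u Ou; have /nbhs_ballP[e /= e0 uO] := open_nbhs_nbhs (conj oO Ou).
  (* A box of radius at most [e / 2] that contains [u] lies in the ball of radius [e] about [u]. *)
  pose n := Num.truncn (2 / e).
  have n0 : (0 : R) < n.+1%:R^-1 by rewrite invr_gt0 ltr0n.
  have ne : n.+1%:R^-1 <= e / 2.
    rewrite -[e / 2]invrK lef_pV2 ?posrE ?invr_gt0 ?divr_gt0// invf_div.
    exact/ltW/truncnS_gt.
  have near_rat (a : R) : exists q : rat, ball (ratr q : R) n.+1%:R^-1 a.
    have [|q] := @rat_in_itvoo R (a - n.+1%:R^-1) (a + n.+1%:R^-1).
      by rewrite ltrBlDr -addrA ltrDl addr_gt0.
    rewrite in_itv/= => /andP[q1 q2]; exists q.
    by rewrite -ball_normE/= ltr_norml ltrBrDl q1 ltrBlDl q2.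
  have [a ua] := near_rat u.1.1; have [b ub] := near_rat u.1.2.
  have [c uc] := near_rat u.2.
  have uq : box (a, b, c, n) u by [].
  exists (a, b, c, n) => // v qv; apply: uO.
  exact: ball_splitr (le_ball ne uq) (le_ball ne qv).
rewrite bigcup_mkcond; apply: countable_bigcupT_measurable => // q.
by case: ifPn.
Qed.

Lemma closed_measurable_space (C : set R3) : closed C -> measurable C.
Proof.
move=> cC; rewrite -[C]setCK; apply: measurableC.
by apply: open_measurable_space; exact: closed_openC.
Qed.

Lemma continuous_dot (T : topologicalType) (f g : T -> R3) :
  continuous f -> continuous g -> continuous (fun t => dot (f t) (g t)).
Proof.
move=> cf cg t.
have h1 (h : T -> R3) : continuous h -> (h s).1 @[s --> t] --> (h t).1.
  by move=> ch; apply: (continuous_comp (f := h) (g := fst));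
    [exact: ch|exact: cvg_fst].
have h3 (h : T -> R3) : continuous h -> (h s).2 @[s --> t] --> (h t).2.
  by move=> ch; apply: (continuous_comp (f := h) (g := snd));
    [exact: ch|exact: cvg_snd].
have h11 (h : T -> R3) : continuous h -> (h s).1.1 @[s --> t] --> (h t).1.1.
  by move=> ch; apply: (continuous_comp (f := fun s => (h s).1) (g := fst));
    [exact: h1|exact: cvg_fst].
have h12 (h : T -> R3) : continuous h -> (h s).1.2 @[s --> t] --> (h t).1.2.
  by move=> ch; apply: (continuous_comp (f := fun s => (h s).1) (g := snd));
    [exact: h1|exact: cvg_snd].
by apply: cvgD; [apply: cvgD|]; apply: cvgM; auto.
Qed.

Lemma continuous_enorm : continuous (@enorm R).
Proof.
move=> u; apply: (continuous_comp (f := fun v => dot v v)).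
  by apply: continuous_dot => v; exact: cvg_id.
exact: sqrt_continuous.
Qed.

Lemma closed_sphere : closed (@sphere R).
Proof.
rewrite (_ : sphere = @enorm R @^-1` [set 1])//.
by apply: (closed_comp (fun u _ => @continuous_enorm u)); exact: closed_eq.
Qed.

Lemma sphere_dot (u : R3) : sphere u -> dot u u = 1.
Proof.
move=> su; have := sqr_sqrtr (_ : 0 <= dot u u).
rewrite -/(enorm u) su expr1n => <- //.
by rewrite /dot -!expr2 !addr_ge0 ?sqr_ge0.
Qed.

Lemma sphere_coord_le1 (u : R3) : sphere u ->
  [/\ `|u.1.1| <= 1, `|u.1.2| <= 1 & `|u.2| <= 1].
Proof.
move=> /sphere_dot; rewrite /dot => d1.
have := sqr_ge0 u.1.1; have := sqr_ge0 u.1.2; have := sqr_ge0 u.2.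
rewrite !expr2 => *.
by split; rewrite -(expr_le1 (n := 2))// expr2 -normrM ger0_norm//; lra.
Qed.

Lemma compact_sphere : compact (@sphere R).
Proof.
have cI : compact (`[-1, 1] : set R) by exact: segment_compact.
apply: (subclosed_compact closed_sphere (compact_setX (compact_setX cI cI) cI)).
by move=> u /sphere_coord_le1[]; rewrite !ler_norml => *;
  split; [split|]; rewrite /= in_itv.
Qed.

Lemma continuous_lift_map : continuous (@lift_map R).
Proof.
move=> u.
have c1 : (fun v : R * R => 2 * pi * v.1) v @[v --> u] --> 2 * pi * u.1.
  by apply: cvgM; [exact: cvg_cst|exact: cvg_fst].
have cs : (fun v : R * R => Num.sqrt (v.2 - v.2 ^+ 2)) v @[v --> u] -->
    Num.sqrt (u.2 - u.2 ^+ 2).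
  apply: (continuous_comp (f := fun v : R * R => v.2 - v.2 ^+ 2));
    last exact: sqrt_continuous.
  by apply: cvgB; [exact: cvg_snd|apply: cvgM; exact: cvg_snd].
have cx : 2 * cos (2 * pi * v.1) * Num.sqrt (v.2 - v.2 ^+ 2) @[v --> u] -->
    2 * cos (2 * pi * u.1) * Num.sqrt (u.2 - u.2 ^+ 2).
  apply: cvgM => //; apply: cvgM; first exact: cvg_cst.
  by apply: cvg_comp c1 _; exact: continuous_cos.
have cy : 2 * sin (2 * pi * v.1) * Num.sqrt (v.2 - v.2 ^+ 2) @[v --> u] -->
    2 * sin (2 * pi * u.1) * Num.sqrt (u.2 - u.2 ^+ 2).
  apply: cvgM => //; apply: cvgM; first exact: cvg_cst.
  by apply: cvg_comp c1 _; exact: continuous_sin.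
have cz : 1 - 2 * v.2 @[v --> u] --> 1 - 2 * u.2.
  apply: cvgB; first exact: cvg_cst.
  by apply: cvgM; [exact: cvg_cst|exact: cvg_snd].
exact: (cvg_pair (cvg_pair cx cy) cz).
Qed.

Lemma compact_unit_square : compact (@unit_square R).
Proof. by apply: compact_setX; exact: segment_compact. Qed.

Lemma grid_cell_uniform (U : pseudoMetricType R) (f : R * R -> U) :
  {within unit_square, continuous f} -> forall e : R, 0 < e ->
  exists M : nat, forall k l : nat, (M <= k)%N -> (M <= l)%N ->
    forall (t : 'I_k * 'I_l) u v, grid_cell t u -> grid_cell t v ->
    ball (f u) e (f v).
Proof.
move=> cf e e0.
have [d d0 H] := compact_uniformly_continuous compact_unit_square cf e0.
(* From this bound on, both sides of a cell are shorter than [d]. *)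
exists (Num.truncn d^-1).+1 => k l Mk Ml t u v tu tv.
have step (n : nat) (i : 'I_n) (a c : R) : (Num.truncn d^-1 < n)%N ->
    i%:R / n%:R <= a < i.+1%:R / n%:R -> i%:R / n%:R <= c < i.+1%:R / n%:R ->
    `|a - c| < d.
  move=> Mn /andP[a1 a2] /andP[c1 c2].
  have n0 : (0 : R) < n%:R by rewrite ltr0n (leq_ltn_trans _ Mn).
  have nd : n%:R^-1 < d.
    rewrite invf_plt ?posrE// (lt_le_trans (truncnS_gt _))//.
    by rewrite ler_nat.
  move: a2 c2; rewrite -natr1 mulrDl mul1r => a2 c2.
  by rewrite ltr_norml; apply/andP; split; lra.
apply: H.
- exact/half_open_unit_square/(grid_cell_sub tu).
- exact/half_open_unit_square/(grid_cell_sub tv).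
move: tu tv => [/= u1 u2] [/= v1 v2]; rewrite !in_itv/= in u1 u2 v1 v2.
by split; [exact: step u1 v1|exact: step u2 v2].
Qed.

(** [ball] belongs to the maximum norm; the comparison constant, the root of 3, is rounded up to
    2. *)
Lemma enorm_ball (u v : R3) (e : R) : 0 <= e -> ball u e v ->
  enorm (u - v) <= 2 * e.
Proof.
move=> e0 [[/= h1 h2] h3].
have sq (a b : R) : ball a e b -> (a - b) ^+ 2 <= e ^+ 2.
  by rewrite /ball/= => ab; rewrite -real_normK ?num_real// lerXn2r ?nnegrE// ltW.
have := sq _ _ h1; have := sq _ _ h2; have := sq _ _ h3.
rewrite !expr2 => g3 g2 g1.
have d4 : dot (u - v) (u - v) <= (2 * e) ^+ 2.
  by rewrite /dot/= expr2; have := mulr_ge0 e0 e0; lra.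
rewrite /enorm (le_trans (ler_wsqrtr d4))// sqrtr_sqr ger0_norm//.
by rewrite mulr_ge0.
Qed.

Lemma lift_map_cell_diam (e : R) : 0 < e ->
  exists M : nat, forall k l : nat, (M <= k)%N -> (M <= l)%N ->
    forall (t : 'I_k * 'I_l) u v, grid_cell t u -> grid_cell t v ->
    enorm (lift_map u - lift_map v) <= e.
Proof.
move=> e0; have e20 : 0 < e / 2 by rewrite divr_gt0.
have [M HM] := grid_cell_uniform (continuous_subspaceT continuous_lift_map) e20.
exists M => k l Mk Ml t u v tu tv.
have -> : e = 2 * (e / 2) by field.
by apply: enorm_ball; [exact: ltW|exact: HM tu tv].
Qed.

End space.

(** * Regular sets and rectangles *)

Section test_sets.
Variable R : realType.
Notation R3 := (R * R * R)%type.

Lemma borel_sigma2_measurable (A : set R3) :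
  measurable A -> A `<=` sphere -> sigma2_measurable A.
Proof. by move=> mA AS; split => //; exact: caratheodory_measurable_mu_ext. Qed.

Lemma regular_sets_boundary_cells (delta0 K e : R) : 0 < delta0 -> 0 < K -> 0 < e ->
  exists M : nat, forall k l : nat, (M <= k)%N -> (M <= l)%N ->
    forall A : set R3, regular_sets delta0 K A ->
    #|boundary_cells (@grid_cell R k l) A|%:R <= e * (k * l)%:R.
Proof.
move=> d0 K0 e0; pose d := Num.min delta0 (e / K).
have dpos : 0 < d by rewrite lt_min d0 divr_gt0.
have [M HM] := lift_map_cell_diam dpos.
(* The successor makes [k] and [l] positive. *)
exists M.+1 => k l Mk Ml A [mA /(_ d dpos)]; rewrite ge_min lexx => /(_ isT) Ad.
have N0 : (0 : R) < (k * l)%:R.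
  by rewrite ltr0n muln_gt0 (leq_trans _ Mk)// (leq_trans _ Ml).
rewrite -ler_pdivrMr//.
have N : #|{: 'I_k * 'I_l}| = (k * l)%N by rewrite card_prod !card_ord.
rewrite -lee_fin -{1}N; apply: (@le_trans _ _ (K * d)%:E); last first.
  by rewrite lee_fin mulrC -ler_pdivlMr// ge_min lexx orbT.
apply: le_trans Ad; apply: sigma2_ext_cells_ge.
- exact: measurable_grid_cell.
- exact: grid_cell_sub.
- exact: grid_cell_inj.
- exact: grid_cellE.
move=> t w /asboolP[[u tu Au] [v tv nAv]] tw.
have S s : grid_cell t s -> sphere (lift_map s).
  by move=> ts; exact/lift_map_sphere/half_open_unit_square/(grid_cell_sub ts).
split; first exact: S.
- apply: (@le_trans _ _ (enorm (lift_map w - lift_map u))%:E).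
    by apply: ereal_inf_lbound; exists (lift_map u).
  by rewrite lee_fin; apply: HM tw tu; exact: ltnW.
- apply: (@le_trans _ _ (enorm (lift_map w - lift_map v))%:E).
    by apply: ereal_inf_lbound; exists (lift_map v) => //; split => //; exact: S.
  by rewrite lee_fin; apply: HM tw tv; exact: ltnW.
Qed.

(** Witnesses that the family is nonempty. No point is near the empty set, whose distance function
    is [+oo]. *)
Lemma regular_sets0 (delta0 K : R) : 0 < K -> regular_sets delta0 K set0.
Proof.
move=> K0; split; first by apply: borel_sigma2_measurable.
move=> d dpos _; rewrite (_ : [set z | _] = set0).
  rewrite /sigma2_ext measurable_mu_extE//= /sigma2 surface_area0 mule0.
  by rewrite lee_fin mulr_ge0// ltW.
apply/seteqP; split => // z [_ + _].
by rewrite /dist image_set0 ereal_inf0 leye_eq.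
Qed.

Lemma card_grid_rows (k l B : nat) (S : {pred 'I_k * 'I_l}) :
  (forall j, #|[pred i | (i, j) \in S]| <= B)%N -> (#|S| <= l * B)%N.
Proof.
move=> HB; rewrite -sum1_card big_mkcond/=.
rewrite (eq_bigr (fun p => if (p.1, p.2) \in S then 1 else 0)%N); last by case.
rewrite -(pair_bigA _ (fun i j => if (i, j) \in S then 1 else 0)%N) exchange_big/=.
rewrite -[l in leqRHS]card_ord -sum_nat_const; apply: leq_sum => j _.
by rewrite -big_mkcond sum1_card; exact: HB.
Qed.

Lemma card_grid_cols (k l B : nat) (S : {pred 'I_k * 'I_l}) :
  (forall i, #|[pred j | (i, j) \in S]| <= B)%N -> (#|S| <= k * B)%N.
Proof.
move=> HB; rewrite -sum1_card big_mkcond/=.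
rewrite (eq_bigr (fun p => if (p.1, p.2) \in S then 1 else 0)%N); last by case.
rewrite -(pair_bigA _ (fun i j => if (i, j) \in S then 1 else 0)%N)/=.
rewrite -[k in leqRHS]card_ord -sum_nat_const; apply: leq_sum => i _.
by rewrite -big_mkcond sum1_card; exact: HB.
Qed.

Lemma card_ord_itv (k a n : nat) (P : {pred 'I_k}) :
  (forall i, i \in P -> a <= i < a + n)%N -> (#|P| <= n)%N.
Proof.
move=> HP; rewrite cardE -(size_map val) -[n in leqRHS](size_iota a).
apply: uniq_leq_size; first by rewrite map_inj_uniq ?enum_uniq//; exact: val_inj.
by move=> _ /mapP[i + ->]; rewrite mem_enum mem_iota; exact: HP.
Qed.

Lemma card_grid_point (k : nat) (a : R) :
  (#|[pred i : 'I_k | (i%:R / k%:R <= a < i.+1%:R / k%:R)%R]| <= 1)%N.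
Proof.
apply/card_le1_eqP => i j; rewrite !inE => /andP[i1 i2] /andP[j1 j2].
by apply/val_inj/eqP; rewrite eqn_leq; apply/andP; split;
  apply: grid_itv_le; eassumption.
Qed.

(** On [[0, 1]] the map [height] is strictly increasing with inverse [colat], so it carries one
    parameter rectangle onto the other. *)
Lemma rectangleE (t1 t2 p1 p2 : R) : 0 <= t1 -> t2 <= 1 -> 0 <= p1 -> p1 < p2 ->
  p2 <= 1 -> rectangle t1 t2 p1 p2 =
  @lift_map R @` (`[t1, t2[ `*` `[height p1, height p2[).
Proof.
move=> t10 t21 p10 p12 p21.
have q1 : 0 <= p1 <= 1 by rewrite p10 (le_trans (ltW p12)).
have q2 : 0 <= p2 <= 1 by rewrite p21 andbT (le_trans p10)// ltW.
apply/seteqP; split.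
  move=> _ [u [tu ut pu up] <-].
  have p01 : 0 <= u.2 <= 1.
    by rewrite (le_trans p10)//= (le_trans (ltW up)).
  exists (u.1, height u.2).
    by split; rewrite /= in_itv/= ?tu ?ut// height_le// height_lt// pu up.
  apply: lift_map_height; split; rewrite /= in_itv//=.
  by rewrite (le_trans t10)//= (le_trans (ltW ut)).
move=> _ [u [/= + +] <-]; rewrite !in_itv/= => /andP[tu ut] /andP[pu up].
have u01 : 0 <= u.2 <= 1.
  have /andP[h1 _] := height01 p1; have /andP[_ h2] := height01 p2.
  by rewrite (le_trans h1)//= (le_trans (ltW up)).
have c01 := colat01 u01.
exists (u.1, colat u.2).
  by split => //=; rewrite -?(height_le q1 c01) -?(height_lt c01 q2) colatK.
rewrite -lift_map_height/= ?colatK -?surjective_pairing//.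
split; rewrite /= in_itv//=.
by rewrite (le_trans t10)//= (le_trans (ltW ut)).
Qed.

(** A half-open rectangle is a countable union of compact ones, and their continuous images are
    compact, hence Borel. *)
Lemma measurable_lift_map_image (a b c d : R) :
  measurable (@lift_map R @` (`[a, b[ `*` `[c, d[)).
Proof.
have -> : `[a, b[ `*` `[c, d[ =
    \bigcup_n (`[a, b - n.+1%:R^-1] `*` `[c, d - n.+1%:R^-1]).
  apply/seteqP; split => [u [/=]|u [n _ [/=]]]; rewrite !in_itv/=.
    move=> /andP[u1 u2] /andP[v1 v2].
    have m0 : 0 < Num.min (b - u.1) (d - u.2) by rewrite lt_min !subr_gt0 u2 v2.
    have [n _ Hn] := near_infty_natSinv_lt (PosNum m0).
    have := Hn n (leqnn n); rewrite /= lt_min => /andP[n1 n2].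
    by exists n => //; split; rewrite /= in_itv/= ?u1 ?v1/= lerBrDr -lerBrDl ltW.
  have n0 : (0 : R) < n.+1%:R^-1 by rewrite invr_gt0 ltr0n.
  move=> /andP[-> h1] /andP[-> h2].
  by rewrite (le_lt_trans h1) ?(le_lt_trans h2)// gtrDl oppr_lt0.
rewrite image_bigcup; apply: bigcupT_measurable => n.
apply: closed_measurable_space; apply: compact_closed.
  exact: norm_hausdorff.
apply: continuous_compact.
  by apply: continuous_subspaceT => u; exact: continuous_lift_map.
by apply: compact_setX; exact: segment_compact.
Qed.

(** The third coordinate fixes the height; off the poles the radius can be cancelled, leaving equal
    cosines and sines of the longitudes. *)
Lemma lift_map_inj (u v : R * R) : 0 <= u.1 < 1 -> 0 <= v.1 < 1 -> 0 < u.2 < 1 ->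
  lift_map u = lift_map v -> u = v.
Proof.
case: u v => [u1 u2] [v1 v2] /= /andP[u10 u11] /andP[v10 v11] /andP[u20 u21].
rewrite /lift_map/= => -[ec es e2].
have e : v2 = u2 by lra.
move: ec es; rewrite e.
have s0 : 0 < Num.sqrt (u2 - u2 ^+ 2) by rewrite sqrtr_gt0 subr_gt0 expr2 gtr_pMr.
have n2 : (2 : R) != 0 by rewrite pnatr_eq0.
move=> /(mulIf (lt0r_neq0 s0)) /(mulfI n2) {}ec.
move=> /(mulIf (lt0r_neq0 s0)) /(mulfI n2) {}es.
congr (_, _); apply/eqP; apply: contraT => uv.
have sin0 : sin (pi * (u1 - v1)) = 0.
  have : cos (2 * pi * u1 - 2 * pi * v1) = 1.
    by rewrite cosB ec es -!expr2 cos2Dsin2.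
  (* With [a = pi * (u1 - v1)], the double-angle formula turns [cos (a + a) = 1] into [sin a = 0];
     below, [|a| < pi] and [a != 0] contradict this. *)
  rewrite (_ : _ - _ = pi * (u1 - v1) + pi * (u1 - v1)); last by ring.
  rewrite cosD -!expr2 cos2sin2 => h.
  by apply/eqP; rewrite -sqrf_eq0; apply/eqP; lra.
have : 0 < sin (pi * `|u1 - v1|).
  apply: sin_gt0_pi; rewrite mulr_gt0 ?pi_gt0 ?normr_gt0 ?subr_eq0//=.
  by rewrite gtr_pMr ?pi_gt0// ltr_norml; apply/andP; split; lra.
have [u0|u0] := ger0P (u1 - v1); first by rewrite sin0 ltxx.
by rewrite mulrN sinN sin0 oppr0 ltxx.
Qed.

(** Where the lifting map is injective, a boundary cell has parameters inside and outside the
    parameter rectangle, so one of the four edge coordinates falls into its column or row; each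
    coordinate does so for one column or row only. *)
Lemma rectangle_boundary_cells (k l : nat) (A : set R3) : rectangles A ->
  (#|boundary_cells (@grid_cell R k l) A| <= 2 * l + 3 * k)%N.
Proof.
move=> [t1 [t2 [p1 [p2 [[t10 t12 t21] [p10 p12 p21] ->]]]]].
rewrite rectangleE//; set c1 := height p1; set c2 := height p2.
have /andP[c10 _] := height01 p1; have /andP[_ c21] := height01 p2.
pose C (n : nat) (a : R) : {pred 'I_n} :=
  [pred i : 'I_n | i%:R / n%:R <= a < i.+1%:R / n%:R].
pose col a : {pred 'I_k * 'I_l} := [pred t | t.1 \in C k a].
pose row a : {pred 'I_k * 'I_l} := [pred t | t.2 \in C l a].
have card_col a : (#|col a| <= l * 1)%N.
  by apply: card_grid_rows => j; exact: card_grid_point.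
have card_row a : (#|row a| <= k * 1)%N.
  by apply: card_grid_cols => i; exact: card_grid_point.
set B := boundary_cells _ _.
suff /subset_leq_card BS : B \subset
    [predU [predU col t1 & col t2] & [predU [predU row c1 & row c2] & row 0]].
  apply: (leq_trans BS); apply: leq_trans (card_predU_le _ _) _.
  apply: (@leq_trans ((l * 1 + l * 1) + (k * 1 + k * 1 + k * 1))); last by lia.
  apply: leq_add.
    by apply: leq_trans (card_predU_le _ _) _; exact: leq_add.
  apply: leq_trans (card_predU_le _ _) _; apply: leq_add => //.
  by apply: leq_trans (card_predU_le _ _) _; exact: leq_add.
apply/fintype.subsetP => t /asboolP[[u tu [w [/= w1 w2] wu]] [v tv nv]].
rewrite !in_itv/= in w1 w2.
(* Row 0 is set aside because its bottom edge is collapsed to the pole. *)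
have [r0|r0] := boolP (t \in row 0); first by apply/orP; right; apply/orP; right.
have [/= uI uJ] := tu; have [/= vI vJ] := tv.
rewrite !in_itv/= in uI uJ vI vJ.
have pos (s : R) : t.2%:R / l%:R <= s -> 0 < s.
  apply: lt_le_trans; rewrite lt0r divr_ge0// andbT.
  apply: contra r0 => /eqP r0; rewrite /row /C !inE/= r0 lexx/=.
  by rewrite divr_gt0// ltr0n (leq_ltn_trans _ (ltn_ord t.2)).
have w0 (s : R) : t.2%:R / l%:R <= s < t.2.+1%:R / l%:R -> 0 < s < 1.
  by move=> /[dup] /andP[/pos -> _] /grid_itv_sub /andP[].
have {w wu w1 w2} [u1 u2] : t1 <= u.1 < t2 /\ c1 <= u.2 < c2.
  suff -> : u = w by [].
  apply: lift_map_inj => //.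
  - exact: grid_itv_sub uI.
  - by case/andP: w1 => ? ?; apply/andP; split; lra.
  - exact: w0 uJ.
have nv' : ~ (t1 <= v.1 < t2 /\ c1 <= v.2 < c2).
  by move=> [v1 v2]; apply: nv; exists v => //; split; rewrite /= in_itv.
have sep (n : nat) (i : 'I_n) (a c s s' : R) : a <= s < c -> ~~ (a <= s' < c) ->
    i%:R / n%:R <= s < i.+1%:R / n%:R -> i%:R / n%:R <= s' < i.+1%:R / n%:R ->
    (i \in C n a) || (i \in C n c).
  move=> /andP[as_ sc] + /andP[s1 s2] /andP[s1' s2'].
  rewrite negb_and -ltNge -leNgt !inE => /orP[s'a|cs'].
    by rewrite (le_trans s1' (ltW s'a)) (le_lt_trans as_ s2).
  by rewrite (le_trans s1 (ltW sc)) (le_lt_trans cs' s2') orbT.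
have [v1|/(sep _ _ _ _ _ _ u1)/(_ uI vI) h] := boolP (t1 <= v.1 < t2); last first.
  by apply/orP; left.
have [v2|/(sep _ _ _ _ _ _ u2)/(_ uJ vJ) h] := boolP (c1 <= v.2 < c2).
  by case: nv'.
by apply/orP; right; apply/orP; left.
Qed.

Lemma rectangles_boundary_cells (e : R) : 0 < e ->
  exists M : nat, forall k l : nat, (M <= k)%N -> (M <= l)%N ->
    forall A : set R3, rectangles A ->
    #|boundary_cells (@grid_cell R k l) A|%:R <= e * (k * l)%:R.
Proof.
(* Once [e * k] and [e * l] are at least 5, the columns take at most [2 / 5] and the rows at most
   [3 / 5] of [e * k * l]. *)
move=> e0; exists (Num.truncn (5 / e)).+1 => k l Mk Ml A RA.
apply: (@le_trans _ _ (2 * l + 3 * k)%:R).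
  by rewrite ler_nat; exact: rectangle_boundary_cells.
have large (n : nat) : (Num.truncn (5 / e) < n)%N -> 5 <= e * n%:R.
  move=> Mn; rewrite -ler_pdivrMl// mulrC ltW// (lt_le_trans (truncnS_gt _))//.
  by rewrite ler_nat.
have hk := large _ Mk; have hl := large _ Ml.
rewrite natrD !natrM.
have h1 := ler_wpM2r (ler0n R l) hk; have h2 := ler_wpM2r (ler0n R k) hl.
by nra.
Qed.

Lemma rectangles_sigma2_measurable : @rectangles R `<=` @sigma2_measurable R.
Proof.
move=> _ [t1 [t2 [p1 [p2 [[t10 t12 t21] [p10 p12 p21] ->]]]]].
rewrite rectangleE//; apply: borel_sigma2_measurable.
  exact: measurable_lift_map_image.
move=> _ [u [/= + +] <-]; rewrite !in_itv/= => /andP[u1 u2] /andP[v1 v2].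
apply: lift_map_sphere; have /andP[h1 _] := height01 p1.
have /andP[_ h2] := height01 p2.
by split; rewrite /= in_itv/=; apply/andP; split; lra.
Qed.

Lemma rectangles_neq0 : @rectangles R !=set0.
Proof.
by exists (rectangle 0 1 0 1); exists 0, 1, 0, 1; split; split.
Qed.

End test_sets.

(** * Caps *)

Section ord_counting.

(* Indices are seen on a cycle of length [k]: the hypothesis forbids three
   elements of [P] at pairwise cyclic distance at least [H]. *)
Lemma card_ord_gap (k H : nat) (P : {pred 'I_k}) :
  (forall i j w, i \in P -> j \in P -> w \in P ->
    i + H <= j -> j + H <= w -> i + k < w + H)%N ->
  (#|P| <= 3 * H)%N.
Proof.
move=> HP; have [i0 i0P|P0] := pickP (mem P); last by rewrite eq_card0.
pose itv a : {pred 'I_k} := [pred i : 'I_k | a <= i < a + H]%N.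
have card_itv a : (#|itv a| <= H)%N by apply: (@card_ord_itv _ a).
case: (arg_minnP (fun i : 'I_k => val i) i0P) => i iP imin.
have [j0 /andP[j0P ij0]|J0] := pickP [pred j in P | (i + H <= j)%N].
  have /arg_minnP : [pred j in P | (i + H <= j)%N] j0 by apply/andP.
  move=> /(_ (fun i : 'I_k => val i))[j /andP[jP ij] jmin].
  (* Here [i] is the least element of [P] and [j] the least one from [i + H] on. An element
     [w >= j + H] satisfies [i + k < w + H], so it is among the last [H] indices. *)
  have PU : P \subset [predU [predU itv i & itv j] & itv (k - H)%N].
    apply/fintype.subsetP => w wP; rewrite !inE; have := imin w wP => iw.
    rewrite iw; have [//|iHw] := ltnP w (i + H).
    have jw := jmin w; rewrite jw ?inE ?wP//=.
    have [//|jHw] := ltnP w (j + H)%N.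
    by have := HP _ _ _ iP jP wP ij jHw; have := ltn_ord w; lia.
  apply: (leq_trans (subset_leq_card PU)); apply: leq_trans (card_predU_le _ _) _.
  rewrite mulSn mul2n -addnn addnC; apply: leq_add => //.
  by apply: leq_trans (card_predU_le _ _) _; exact: leq_add.
have PU : P \subset itv i.
  apply/fintype.subsetP => w wP; rewrite inE (imin w wP)/= ltnNge.
  by apply/negP => iHw; have := J0 w; rewrite inE wP iHw.
by rewrite (leq_trans (subset_leq_card PU))// (leq_trans (card_itv _))// leq_pmull.
Qed.

Lemma card_ord_close (R : realType) (k : nat) (P : {pred 'I_k}) (d : R) :
  (forall i j, i \in P -> j \in P -> j%:R - i%:R <= d) -> 0 <= d ->
  #|P|%:R <= d + 1.
Proof.
move=> HP d0; have [i0 i0P|P0] := pickP (mem P); last first.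
  by rewrite eq_card0// addr_ge0.
case: (arg_minnP (fun i : 'I_k => val i) i0P) => i iP imin.
apply: (@le_trans _ _ (Num.truncn d).+1%:R); last first.
  by rewrite -natr1 lerD2r truncn_le.
rewrite ler_nat; apply: (@card_ord_itv _ i) => j jP.
rewrite (imin j jP)/= addnS ltnS.
rewrite -leq_subLR truncn_ge_nat// natrB; [exact: HP|exact: imin].
Qed.

End ord_counting.

Section caps.
Variable R : realType.
Notation R3 := (R * R * R)%type.

(** Cauchy-Schwarz from the Lagrange identity for dot and cross product. *)
Lemma dot_le_enorm (u v : R3) : sphere v -> `|dot u v| <= enorm u.
Proof.
move=> /sphere_dot vv; rewrite -sqrtr_sqr /enorm; apply: ler_wsqrtr.
have -> : dot u u = dot u v ^+ 2 + dot (cross u v) (cross u v).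
  rewrite -[LHS]mulr1 -vv /dot /cross/=; ring.
by rewrite lerDl /dot -!expr2 !addr_ge0// sqr_ge0.
Qed.

(** Signed distance of the lifted point from the plane bounding the cap, for a unit vector [z]. *)
Definition level (z : R3) (t : R) (u : R * R) : R := dot (lift_map u) z - t.

(** The level is nonpositive at one point of the cell and positive at another, and by [dot_le_enorm]
    the corner value differs from each by at most [e]. *)
Lemma cap_boundary_level (k l : nat) (e t : R) (z : R3) (c : 'I_k * 'I_l) :
  (forall u v, grid_cell c u -> grid_cell c v ->
    enorm (lift_map u - lift_map v) <= e) ->
  sphere z -> c \in boundary_cells (@grid_cell R k l) (cap z t) ->
  `|level z t (c.1%:R / k%:R, c.2%:R / l%:R)| <= e.
Proof.
move=> He sz /asboolP[[u cu [_ uz]] [v cv nv]].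
have cc : grid_cell c (c.1%:R / k%:R : R, c.2%:R / l%:R : R).
  have h (n : nat) (i : 'I_n) : (i%:R / n%:R : R) <= i%:R / n%:R < i.+1%:R / n%:R.
    rewrite lexx/= ltr_pM2r ?ltr_nat// invr_gt0 ltr0n.
    exact: leq_trans (ltn_ord i).
  by split; rewrite /= in_itv; exact: h.
have near s : grid_cell c s ->
    `|level z t (c.1%:R / k%:R, c.2%:R / l%:R) - level z t s| <= e.
  move=> cs; apply: le_trans (He _ _ cc cs).
  rewrite (_ : _ - _ = dot (lift_map (c.1%:R / k%:R, c.2%:R / l%:R) - lift_map s) z).
    exact: dot_le_enorm.
  by rewrite /level /dot/=; ring.
have vz : t < dot (lift_map v) z.
  rewrite ltNge; apply/negP => vz; apply: nv; split => //.
  exact/lift_map_sphere/half_open_unit_square/(grid_cell_sub cv).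
move: (near _ cu) (near _ cv); rewrite !ler_norml.
move: uz vz; rewrite /level => uz vz /andP[u1 u2] /andP[v1 v2].
by apply/andP; split; lra.
Qed.

(** The sine is the cosine of the distance to [pi / 2], which is at most [pi / 2 - pi * h] here, and
    the cosine decreases on [[0, pi]]. *)
Lemma sin_pi_ge (h d : R) : 0 <= h -> h <= d -> d <= 1 - h ->
  sin (pi * h) <= sin (pi * d).
Proof.
move=> h0 hd dh; have p0 := pi_gt0 R.
have cosA (s : R) : cos `|s| = cos s.
  by have [//|] := ger0P s; rewrite cosN.
have hp : `|pi * d - pi / 2| <= pi / 2 - pi * h.
  by rewrite ler_norml; apply/andP; split; nra.
rewrite -!cosBpihalf -[leRHS]cosA -[leLHS]cosN opprB leNgt ltr_cos -?leNgt//.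
  by rewrite in_itv/= (le_trans _ hp)//=; nra.
by rewrite in_itv/= normr_ge0 (le_trans hp)//; nra.
Qed.

(* With [g s = a sin s - b cos s], the difference [f p - f q] is
   [2 sin (pi (q - p)) g (pi (p + q))], so [g] is small at both [pi (x + y)] and
   [pi (y + w)]; and [a sin (u - v) = g u cos v - g v cos u], likewise for [b]. *)
Lemma trig_level_gap (a b c h e x y w : R) : 0 < h -> h <= 1 / 2 ->
  let f s := a * cos (2 * pi * s) + b * sin (2 * pi * s) + c in
  x + h <= y -> y + h <= w -> w - x <= 1 - h ->
  `|f x| <= e -> `|f y| <= e -> `|f w| <= e ->
  `|a| * sin (pi * h) ^+ 2 <= 2 * e /\ `|b| * sin (pi * h) ^+ 2 <= 2 * e.
Proof.
move=> h0 h2 f xy yw wx fx fy fw.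
pose g s := a * sin s - b * cos s.
have p0 := pi_gt0 R.
have s0 : 0 < sin (pi * h) by apply: sin_gt0_pi; apply/andP; split; nra.
have step (p q : R) : p + h <= q -> q - p <= 1 - h -> `|f p| <= e -> `|f q| <= e ->
    `|g (pi * (p + q))| * sin (pi * h) <= e.
  move=> pq qp fp fq.
  have sq : sin (pi * h) <= sin (pi * (q - p)) by apply: sin_pi_ge; lra.
  have E : f p - f q = 2 * (sin (pi * (q - p)) * g (pi * (p + q))).
    rewrite /f /g.
    have -> : 2 * pi * p = pi * (p + q) - pi * (q - p) by ring.
    have -> : 2 * pi * q = pi * (p + q) + pi * (q - p) by ring.
    by rewrite cosB sinB cosD sinD; ring.
  have : `|f p - f q| <= 2 * e by rewrite (le_trans (ler_normB _ _))//; lra.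
  rewrite E !normrM (@ger0_norm _ 2)// (ger0_norm (le_trans (ltW s0) sq)) ler_pM2l//.
  by apply: le_trans; rewrite mulrC ler_wpM2r.
have g1 : `|g (pi * (x + y))| * sin (pi * h) <= e by apply: step => //; lra.
have g2 : `|g (pi * (y + w))| * sin (pi * h) <= e by apply: step => //; lra.
set u := pi * (x + y) in g1; set v := pi * (y + w) in g2.
have suv : sin (pi * h) <= `|sin (u - v)|.
  have -> : u - v = - (pi * (w - x)) by rewrite /u /v; ring.
  rewrite sinN normrN; apply: le_trans (ler_norm _).
  by apply: sin_pi_ge; lra.
have comb (A : R) (p q : R) : `|p| <= 1 -> `|q| <= 1 ->
    A * sin (u - v) = g u * p - g v * q -> `|A| * sin (pi * h) ^+ 2 <= 2 * e.
  move=> p1 q1 E; have E' : `|A| * `|sin (u - v)| <= `|g u| + `|g v|.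
    rewrite -normrM E (le_trans (ler_normB _ _))// lerD// normrM ler_piMr//.
  rewrite expr2; have A0 := normr_ge0 A.
  have h1 : `|A| * sin (pi * h) <= `|g u| + `|g v|.
    by apply: le_trans E'; exact: ler_wpM2l.
  by rewrite mulrA (le_trans (ler_wpM2r (ltW s0) h1))// mulrDl; lra.
have c1 s : `|cos s| <= 1 by rewrite ler_norml cos_geN1 cos_le1.
have s1 s : `|sin s| <= 1 by rewrite ler_norml sin_geN1 sin_le1.
split; [apply: (comb _ (cos v) (cos u)) => //|apply: (comb _ (sin v) (sin u)) => //];
  rewrite sinB /g; ring.
Qed.

(** For [y] in [[0, 1]], the radius of the circle in which the sphere meets the plane at third
    coordinate [1 - 2 * y]. *)
Definition parallel_radius (y : R) : R := 2 * Num.sqrt (y - y ^+ 2).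

Lemma parallel_radius_sqr (y : R) : 0 <= y <= 1 ->
  0 <= parallel_radius y /\ parallel_radius y ^+ 2 = 4 * (y - y ^+ 2).
Proof.
move=> /andP[y0 y1]; rewrite /parallel_radius mulr_ge0 ?sqrtr_ge0// exprMn sqr_sqrtr.
  by split => //; congr (_ * _); ring.
by rewrite subr_ge0 expr2 ler_piMr.
Qed.

Lemma parallel_radius_le1 (y : R) : 0 <= y <= 1 -> parallel_radius y <= 1.
Proof.
move=> y01; have [r0 r2] := parallel_radius_sqr y01.
by rewrite -(expr_le1 (n := 2))// r2; have := sqr_ge0 (2 * y - 1); nra.
Qed.

(** Both factors of [y * (1 - y)] are at least [q]. *)
Lemma parallel_radius_ge (q y : R) : 0 < q -> q <= y -> y <= 1 - q ->
  2 * q <= parallel_radius y.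
Proof.
move=> q0 qy yq; have y01 : 0 <= y <= 1 by apply/andP; split; lra.
have [r0 r2] := parallel_radius_sqr y01.
have q20 : 0 <= 2 * q by rewrite mulr_ge0// ltW.
rewrite -(ler_pXn2r (n := 2))// r2; nra.
Qed.

Lemma levelE (z : R3) (t x y : R) : level z t (x, y) =
  parallel_radius y * z.1.1 * cos (2 * pi * x) +
  parallel_radius y * z.1.2 * sin (2 * pi * x) + ((1 - 2 * y) * z.2 - t).
Proof. rewrite /level /parallel_radius /dot /lift_map/=; ring. Qed.

(** Off the poles and for [z] off the axis, one of the two trigonometric coefficients is at least
    [2 * q * q] in absolute value. Three indices at pairwise cyclic distance [q * k] or more would
    contradict [trig_level_gap], so [card_ord_gap] applies. *)
Lemma card_level_parallel (k : nat) (q e t y : R) (z : R3) :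
  0 < q -> q <= 1 / 2 -> e < q ^+ 2 * sin (pi * q) ^+ 2 ->
  q <= `|z.1.1| \/ q <= `|z.1.2| -> q <= y -> y <= 1 - q ->
  (#|[pred i : 'I_k | (`|level z t (i%:R / k%:R, y)| <= e)%R]| <=
   3 * (Num.truncn (q * k%:R)).+1)%N.
Proof.
move=> q0 q2 eq qz qy yq; apply: card_ord_gap => i j w.
rewrite !inE !levelE => Pi Pj Pw ij jw; rewrite ltnNge; apply/negP => wi.
set H := (Num.truncn _).+1 in ij jw wi.
have k0 : (0 : R) < k%:R by rewrite ltr0n; exact: leq_trans (ltn_ord i).
have qH : q <= H%:R / k%:R.
  by rewrite ler_pdivlMr// ltW// truncnS_gt.
have gap (n p : nat) : (n + H <= p)%N -> n%:R / k%:R + q <= p%:R / k%:R.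
  move=> np; apply: (@le_trans _ _ ((n + H)%:R / k%:R)).
    by rewrite natrD mulrDl lerD2l.
  by rewrite ler_pM2r ?invr_gt0// ler_nat.
(* The third gap, from [w] around the circle back to [i]. *)
have wi' : w%:R / k%:R + q <= i%:R / k%:R + 1.
  apply: (@le_trans _ _ ((w + H)%:R / k%:R)).
    by rewrite natrD mulrDl lerD2l.
  rewrite -[X in _ <= _ + X](mulfV (lt0r_neq0 k0)) -mulrDl -natrD.
  by rewrite ler_pM2r ?invr_gt0// ler_nat.
have s0 : 0 < sin (pi * q) by apply: sin_gt0_pi; have := pi_gt0 R; nra.
have [|h1 h2] := trig_level_gap q0 q2 (gap _ _ ij) (gap _ _ jw) _ Pi Pj Pw.
  lra.
have r2q := parallel_radius_ge q0 qy yq.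
have contra (a : R) : q <= `|a| ->
    `|parallel_radius y * a| * sin (pi * q) ^+ 2 <= 2 * e -> False.
  move=> qa; rewrite normrM ger0_norm; last first.
    by rewrite (le_trans _ r2q)// mulr_ge0// ltW.
  have : 2 * q * q <= parallel_radius y * `|a|.
    by apply: ler_pM => //; rewrite ?mulr_ge0// ltW.
  move=> /(ler_wpM2r (ltW (exprn_gt0 2 s0))).
  move: eq; rewrite expr2; lra.
by case: qz => qz; [exact: contra h1|exact: contra h2].
Qed.

(** For [z] near the axis the trigonometric terms are at most [q] each, so a small level puts the
    affine function [(1 - 2 * y) * z.2 - t] within [3 * q] of 0. Its slope is at least 1 in absolute
    value, because [|z.2| >= 1 / 2], and [y] is confined to length [6 * q]. *)
Lemma card_level_meridian (l : nat) (q e t x : R) (z : R3) :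
  0 < q -> q <= 1 / 4 -> e <= q -> sphere z -> `|z.1.1| <= q -> `|z.1.2| <= q ->
  #|[pred j : 'I_l | `|level z t (x, j%:R / l%:R)| <= e]|%:R <= 6 * q * l%:R + 1.
Proof.
move=> q0 q4 eq /sphere_dot sz z1 z2; apply: card_ord_close; last first.
  by rewrite !mulr_ge0// ltW.
have close (j : 'I_l) : `|level z t (x, j%:R / l%:R)| <= e ->
    `|(1 - 2 * (j%:R / l%:R)) * z.2 - t| <= 3 * q.
  have y01 : 0 <= (j%:R / l%:R : R) <= 1.
    have l0 : (0 : R) < l%:R by rewrite ltr0n; exact: leq_ltn_trans (ltn_ord j).
    by rewrite divr_ge0//= ler_pdivrMr// mul1r ler_nat ltnW.
  have [r0 _] := parallel_radius_sqr y01; have r1 := parallel_radius_le1 y01.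
  rewrite levelE.
  have small (r a s : R) : 0 <= r -> r <= 1 -> `|a| <= q -> `|s| <= 1 ->
      `|r * a * s| <= q.
    move=> ? ? aq s1; rewrite !normrM (@ger0_norm _ r)// -[q]mul1r -[_ * q]mulr1.
    by rewrite ler_pM ?mulr_ge0// ler_pM.
  have := small _ _ (cos (2 * pi * x)) r0 r1 z1.
  rewrite !ler_norml cos_geN1 cos_le1.
  move=> /(_ isT) /andP[h1 h2].
  have := small _ _ (sin (2 * pi * x)) r0 r1 z2.
  rewrite !ler_norml sin_geN1 sin_le1.
  move=> /(_ isT) /andP[h3 h4] /andP[h5 h6].
  by apply/andP; split; lra.
move=> i j; rewrite !inE => /close + /close; rewrite !ler_norml.
move=> /andP[i1 i2] /andP[j1 j2].
have l0 : (0 : R) < l%:R by rewrite ltr0n; exact: leq_ltn_trans (ltn_ord i).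
have z3 : 1 / 4 <= z.2 ^+ 2.
  have sq (a : R) : `|a| <= q -> a ^+ 2 <= q ^+ 2.
    by move=> aq; rewrite -real_normK ?num_real// lerXn2r ?nnegrE// ltW.
  have := sq _ z1; have := sq _ z2; move: sz; rewrite /dot.
  by rewrite !expr2; nra.
rewrite -ler_pdivrMr// mulrBl.
set y := j%:R / l%:R in j1 j2 *; set y' := i%:R / l%:R in i1 i2 *.
have [yy|yy] := leP (y - y') 0; first by rewrite (le_trans yy)// mulr_ge0// ltW.
have [z0|z0] := ger0P z.2.
  have : 1 / 2 <= z.2 by rewrite leNgt; apply/negP => zh; nra.
  by move=> zh; nra.
have : z.2 <= - (1 / 2) by rewrite leNgt; apply/negP => zh; nra.
by move=> zh; nra.
Qed.

Lemma caps_boundary_cells (e : R) : 0 < e ->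
  exists M : nat, forall k l : nat, (M <= k)%N -> (M <= l)%N ->
    forall A : set R3, caps A ->
    #|boundary_cells (@grid_cell R k l) A|%:R <= e * (k * l)%:R.
Proof.
(* The two cases below give at most [7 * q * k * l] and [10 * q * k * l] cells, so [16 * q <= e] is
   enough; [q <= 1 / 16] meets the thresholds [1 / 4] and [1 / 2] of the counting lemmas. *)
move=> e0; pose q := Num.min e 1 / 16.
have q0 : 0 < q by rewrite divr_gt0// lt_min e0/=.
have qe : 16 * q <= e by rewrite mulrC divfK// ge_min lexx.
have q16 : q <= 1 / 16 by rewrite ler_pM2r// ge_min lexx orbT.
move: q q0 qe q16 => q q0 qe q16.
have s0 : 0 < sin (pi * q) by apply: sin_gt0_pi; have := pi_gt0 R; nra.
have d0 : 0 < q ^+ 2 * sin (pi * q) ^+ 2 by rewrite mulr_gt0// exprn_gt0.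
(* The first bound is for [card_level_meridian]; the half in the second gives the strict inequality
   of [card_level_parallel]. *)
pose d := Num.min q (q ^+ 2 * sin (pi * q) ^+ 2 / 2).
have dpos : 0 < d by rewrite lt_min q0 divr_gt0.
have dq : d <= q by rewrite ge_min lexx.
have ds : d < q ^+ 2 * sin (pi * q) ^+ 2.
  by rewrite gt_min; apply/orP; right; rewrite ltr_pdivrMr// ltr_pMr// ltr1n.
have [M HM] := lift_map_cell_diam dpos.
(* The second bound gives [1 <= q * k] and [1 <= q * l], which absorbs the additive constants of the
   counts. *)
exists (maxn M (Num.truncn q^-1).+1) => k l.
rewrite !geq_max => /andP[Mk Qk] /andP[Ml Ql] _ [z [t [sz _ _ ->]]].
have large (n : nat) : (Num.truncn q^-1 < n)%N -> 1 <= q * n%:R.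
  move=> qn; rewrite -ler_pdivrMl// mulr1 ltW// (lt_le_trans (truncnS_gt _))//.
  by rewrite ler_nat.
have qk := large _ Qk; have ql := large _ Ql.
set S := boundary_cells _ _.
have levelS c : c \in S -> `|level z t (c.1%:R / k%:R, c.2%:R / l%:R)| <= d.
  by apply: cap_boundary_level => // u v; exact: HM.
have kl0 : (0 : R) <= k%:R * l%:R by rewrite mulr_ge0.
have kql : k%:R <= q * (k%:R * l%:R).
  by rewrite mulrCA -[leLHS]mulr1 ler_wpM2l.
have lqk : l%:R <= q * (k%:R * l%:R).
  by rewrite mulrA -[leLHS]mul1r ler_wpM2r.
have qkl0 := le_trans (ler0n R k) kql.
have bnd : 16 * q * (k%:R * l%:R) <= e * (k%:R * l%:R) by rewrite ler_wpM2r.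
rewrite natrM; apply: le_trans bnd.
(* For [z] near the axis cells are counted along columns, otherwise along rows. *)
have [z12|] := boolP ((q <= `|z.1.1|) || (q <= `|z.1.2|)); last first.
  rewrite negb_or -!ltNge => /andP[/ltW z1 /ltW z2].
  have B0 : 0 <= 6 * q * l%:R + 1 by rewrite addr_ge0// !mulr_ge0// ltW.
  apply: (@le_trans _ _ (k * Num.truncn (6 * q * l%:R + 1))%:R).
    rewrite ler_nat; apply: card_grid_cols => i.
    rewrite truncn_ge_nat//.
    apply: le_trans (card_level_meridian l t (i%:R / k%:R) q0 _ dq sz z1 z2);
      last lra.
    rewrite ler_nat; apply/subset_leq_card/fintype.subsetP => j jS.
    exact: (levelS (i, j) jS).
  have := B0; rewrite -truncn_le natrM => /(ler_wpM2l (ler0n R k)).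
  by move: kql qkl0; lra.
(* The rows near the two poles, where [parallel_radius] may be too small, are counted in full. *)
pose lo : {pred 'I_l} := [pred j : 'I_l | j%:R / l%:R <= q].
pose hi : {pred 'I_l} := [pred j : 'I_l | 1 - q <= j%:R / l%:R].
have l0 : (0 : R) < l%:R by rewrite ltr0n (leq_trans _ Ql).
have card_lo : #|lo|%:R <= q * l%:R + 1.
  apply: card_ord_close; last by rewrite mulr_ge0// ltW.
  move=> i j _; rewrite inE ler_pdivrMr// => jq.
  by rewrite (le_trans _ jq)// gerBl.
have card_hi : #|hi|%:R <= q * l%:R + 1.
  apply: card_ord_close; last by rewrite mulr_ge0// ltW.
  move=> i j; rewrite inE ler_pdivlMr// => iq _.
  have : j%:R <= l%:R :> R by rewrite ler_nat ltnW.
  by move: iq; lra.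
pose mid : {pred 'I_k * 'I_l} := [pred c in S | (c.2 \notin lo) && (c.2 \notin hi)].
pose low : {pred 'I_k * 'I_l} := [pred c | c.2 \in lo].
pose high : {pred 'I_k * 'I_l} := [pred c | c.2 \in hi].
have card_mid : (#|mid| <= l * (3 * (Num.truncn (q * k%:R)).+1))%N.
  apply: card_grid_rows => j.
  have [/andP[jlo jhi]|jbad] := boolP ((j \notin lo) && (j \notin hi)); last first.
    by rewrite eq_card0// => i; rewrite !inE/= in jbad *; rewrite (negbTE jbad) andbF.
  have j1 : q <= j%:R / l%:R by move: jlo; rewrite inE/= -ltNge => /ltW.
  have j2 : j%:R / l%:R <= 1 - q by move: jhi; rewrite inE/= -ltNge => /ltW.
  have q2 : q <= 1 / 2 by lra.
  apply: leq_trans (card_level_parallel k t q0 q2 ds (orP z12) j1 j2).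
  apply/subset_leq_card/fintype.subsetP => i /andP[iS _].
  exact: (levelS (i, j) iS).
have SU : (#|S| <= #|mid| + (k * #|lo| + k * #|hi|))%N.
  have /subset_leq_card HS : S \subset [predU mid & [predU low & high]].
    apply/fintype.subsetP => c cS.
    have [clo|clo] := boolP (c.2 \in lo).
      by apply/orP; right; apply/orP; left.
    have [chi|chi] := boolP (c.2 \in hi).
      by apply/orP; right; apply/orP; right.
    by apply/orP; left; apply/andP; split => //; apply/andP.
  apply: (leq_trans HS); apply: leq_trans (card_predU_le _ _) _.
  rewrite leq_add2l; apply: leq_trans (card_predU_le _ _) _; apply: leq_add.
    by apply: card_grid_cols => i; apply/subset_leq_card/fintype.subsetP => j.
  by apply: card_grid_cols => i; apply/subset_leq_card/fintype.subsetP => j.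
have {}SU := leq_trans SU (leq_add card_mid (leqnn _)).
apply: (@le_trans _ _ (l%:R * (3 * (q * k%:R + 1)) +
    (k%:R * #|lo|%:R + k%:R * #|hi|%:R))).
  apply: (@le_trans _ _ (l * (3 * (Num.truncn (q * k%:R)).+1) +
      (k * #|lo| + k * #|hi|))%:R).
    by rewrite ler_nat.
  rewrite !natrD !natrM lerD2r ler_wpM2l// ler_wpM2l// -natr1 lerD2r truncn_le//.
  by rewrite mulr_ge0// ltW.
have h1 := ler_wpM2l (ler0n R k) card_lo; have h2 := ler_wpM2l (ler0n R k) card_hi.
by move: kql lqk h1 h2 qkl0; lra.
Qed.

Lemma caps_sigma2_measurable : @caps R `<=` @sigma2_measurable R.
Proof.
move=> _ [z [t [_ _ _ ->]]]; apply: borel_sigma2_measurable; last by move=> y [].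
apply: closed_measurable_space.
apply: (closedI (@closed_sphere R)).
apply: (closed_comp (f := fun y => dot y z) (D := [set s | s <= t])).
  by move=> y _; apply: continuous_dot => s; [exact: cvg_id|exact: cvg_cst].
exact: closed_le.
Qed.

Lemma caps_neq0 : @caps R !=set0.
Proof.
exists (cap (1, 0, 0) 0), (1, 0, 0), 0; split => //.
  by rewrite /sphere/= /enorm /dot/= mulr1 !mulr0 !addr0 sqrtr1.
Qed.

End caps.

(** * Equidistribution *)

Section equidistribution.

(** Each [c t / #|T|] is the integral of the constant [c t] over its cell, so the error splits into
    cell integrals of at most [e / #|T|]. *)
Lemma Rintegral_partition_dist d (X : measurableType d) (R : realType)
    (nu : {measure set X -> \bar R}) (T : finType) (cell : T -> set X)
    (h : X -> R) (c : T -> R) (H : set X) (e : R) :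
  (0 < #|T|)%N -> (forall t, measurable (cell t)) ->
  (forall t t' u, cell t u -> cell t' u -> t = t') ->
  H = \bigcup_t cell t -> (forall t, nu (cell t) = (#|T|%:R^-1)%:E) ->
  nu.-integrable H (EFin \o h) ->
  (forall t u, cell t u -> `|h u - c t| <= e) ->
  `|(\int[nu]_(u in H) h u)%R - (\sum_t c t) / #|T|%:R| <= e.
Proof.
move=> T0 mcell cell_inj HE cellE inth close.
have N0 : (0 : R) < #|T|%:R by rewrite ltr0n.
have cellH t : cell t `<=` H by rewrite HE => u tu; exists t.
have intc t : nu.-integrable (cell t) (EFin \o h).
  by apply: integrableS inth => //; rewrite HE; exact: fin_bigcup_measurable.
have cstc t (r : R) : nu.-integrable (cell t) (EFin \o cst r).
  apply: measurable_bounded_integrable => //; first by rewrite cellE ltry.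
  by exists `|r|; split => // M rM u _; exact: ltW.
have -> : (\int[nu]_(u in H) h u)%R = \sum_t (\int[nu]_(u in cell t) h u)%R.
  have HU : H = \big[setU/set0]_(t <- index_enum T) cell t.
    rewrite HE -bigcup_seq.
    by apply/seteqP; split => u [t _ tu]; exists t => //=; rewrite mem_index_enum.
  rewrite {1}/Rintegral {1}HU integral_bigsetU_EFin//; last 3 first.
  - exact: index_enum_uniq.
  - by move=> t t' _ _ [u [tu t'u]]; exact: cell_inj tu t'u.
  - by rewrite -HU; exact: measurable_int inth.
  rewrite (eq_bigr (fun t => (\int[nu]_(u in cell t) h u)%R%:E)) ?sumEFin//.
  by move=> t _; rewrite fineK//; exact: integrable_fin_num.
rewrite mulr_suml -sumrB.
apply: (le_trans (ler_norm_sum _ _ _)).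
have eE : e = \sum_(t : T) e / #|T|%:R.
  by rewrite big_const iter_addr_0 -(mulr_natr (e / _)) divfK ?gt_eqF.
rewrite [leRHS]eE.
apply: ler_sum => t _.
have divE (r : R) : r / #|T|%:R = (\int[nu]_(u in cell t) r)%R.
  by rewrite Rintegral_cst// cellE.
rewrite [c t / _]divE -RintegralB//; last exact: cstc.
have intd : nu.-integrable (cell t) (EFin \o (fun u => h u - c t)).
  rewrite (_ : _ \o _ = (EFin \o h) \- (EFin \o cst (c t)))%E; last first.
    by apply/funext => u /=; rewrite EFinB.
  by apply: integrableB => //; exact: cstc.
apply: (le_trans (le_normr_Rintegral _ intd)) => //.
rewrite divE; apply: le_Rintegral => //; first exact: integrable_norm intd.
  exact: cstc.
by move=> u; exact: close.
Qed.

Lemma grid_cell_cover (R : realType) (k l : nat) : (0 < k)%N -> (0 < l)%N ->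
  half_open_square = \bigcup_(t : 'I_k * 'I_l) @grid_cell R k l t.
Proof.
move=> k0 l0; apply/seteqP; split; last by move=> u [t _]; exact: grid_cell_sub.
have itv (n : nat) (s : R) : (0 < n)%N -> 0 <= s < 1 ->
    exists i : 'I_n, i%:R / n%:R <= s < i.+1%:R / n%:R.
  move=> n0 /andP[s0 s1]; have N0 : (0 : R) < n%:R by rewrite ltr0n.
  have ns0 : 0 <= s * n%:R by rewrite mulr_ge0.
  have lt_n : (Num.truncn (s * n%:R) < n)%N.
    by rewrite truncn_lt_nat// gtr_pMl.
  exists (Ordinal lt_n) => /=.
  by rewrite ler_pdivrMr// truncn_le// ns0/= ltr_pdivlMr// truncnS_gt.
move=> u [/=]; rewrite !in_itv/= => /(itv _ _ k0)[i ui] /(itv _ _ l0)[j uj].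
by exists (i, j) => //; split; rewrite /= in_itv.
Qed.

Section integral.
Variable R : realType.
Notation leb := (@lebesgue_measure R).
Notation R3 := (R * R * R)%type.

Lemma measurable_half_open_square : measurable (@half_open_square R).
Proof. by apply: measurableX; exact: measurable_itv. Qed.

(** Restricting the measure, and not only the domain of integration, gives a finite measure on the
    plane whose image under [lift_map] is [sigma2], and makes bounded measurable functions
    integrable. *)
Definition half_open_square_measure :
    {measure set (measurableTypeR R * measurableTypeR R) -> \bar R} :=
  mrestr (leb \x leb)%E measurable_half_open_square.

Lemma half_open_square_measureE (A : set (R * R)) :
  half_open_square_measure A = (leb \x leb)%E (A `&` half_open_square).
Proof. by []. Qed.

Lemma continuous_measurable_sphere (f : R3 -> R) :
  {within sphere, continuous f} -> measurable_fun sphere f.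
Proof.
move=> cf; apply: (measurability _ (RGenOpens.measurableE R)) => //.
move=> _ [_ [a [b ->] <-]].
have /open_subspaceP[V oV VS] : open (f @^-1` `]a, b[ : set (subspace sphere)).
  by move/continuousP: cf; apply; exact: interval_open.
rewrite setIC -VS; apply: measurableI; last exact: measurable_sphere.
exact: open_measurable_space.
Qed.

Lemma continuous_sphere_bounded (f : R3 -> R) : {within sphere, continuous f} ->
  exists M : R, forall z, sphere z -> `|f z| <= M.
Proof.
move=> cf; have := continuous_compact cf (@compact_sphere R).
move=> /compact_bounded[M [_ HM]]; exists (M + 1) => z sz.
by apply: HM; [rewrite ltrDl|exists z].
Qed.

(** Change of variables along [lift_map], justified by [sigma2E]; continuity on the compact sphere
    makes [f] bounded and hence integrable. *)
Lemma sigma2_integralE (f : R3 -> R) : {within sphere, continuous f} ->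
  half_open_square_measure.-integrable half_open_square
    (EFin \o (f \o @lift_map R)) /\
  \int[@sigma2 R]_(z in sphere) f z =
  \int[half_open_square_measure]_(u in half_open_square) f (lift_map u).
Proof.
move=> cf; set nu := half_open_square_measure.
have mS := @measurable_sphere R; have mH := measurable_half_open_square.
(* The pushforward formula asks for a function measurable on the whole space. *)
pose g := f \_ sphere.
have mg : measurable_fun setT g.
  by apply/(measurable_restrictT _ mS); exact: (continuous_measurable_sphere cf).
have [M HM] := continuous_sphere_bounded cf.
have gM z : `|g z| <= `|M|.
  rewrite /g patchE; case: ifPn => [|_]; last by rewrite normr0.
  by rewrite inE => /HM /le_trans; apply; exact: ler_norm.
have mgl : measurable_fun setT (g \o @lift_map R).
  by apply: measurableT_comp mg _; exact: measurable_lift_map.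
have intD (D : set (R * R)) : measurable D ->
    nu.-integrable D (EFin \o (g \o @lift_map R)).
  move=> mD; apply: measurable_bounded_integrable => //.
  - rewrite /nu half_open_square_measureE (@le_lt_trans _ _ 1%E) ?ltry//.
    rewrite -(@half_open_squareE R) le_measure ?inE//; exact: measurableI.
  - exact: measurable_funTS.
  - exists `|M|; split => // r Mr u _; exact: le_trans (gM _) (ltW Mr).
have HS (u : R * R) : half_open_square u -> sphere (lift_map u).
  by move=> Hu; exact/lift_map_sphere/half_open_unit_square.
have gS z : sphere z -> g z = f z by move=> Sz; rewrite /g patchE mem_set.
have gf u : half_open_square u -> g (lift_map u) = f (lift_map u).
  by move=> Hu; apply: gS; exact: HS.
split.
  apply: eq_integrable (intD _ mH) => // u; rewrite inE => Hu /=.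
  by rewrite gf.
have mP : measurable (@lift_map R @^-1` sphere).
  by rewrite -[X in measurable X]setTI; exact: measurable_lift_map.
transitivity (\int[nu]_(u in @lift_map R @^-1` sphere) g (lift_map u)).
  congr fine.
  transitivity (\int[pushforward nu (@lift_map R)]_(z in sphere) (f z)%:E)%E.
    apply: eq_measure_integral; first exact: measurable_lift_map.
    move=> mL A mA _; rewrite [RHS]half_open_square_measureE setIC.
    exact: sigma2E.
  rewrite -(integral_pushforward _ (f := EFin \o g))//.
  - apply: eq_integral; first exact: measurable_lift_map.
    by move=> z; rewrite inE => zS /=; rewrite gS.
  - exact: measurable_lift_map.
  - exact/measurable_EFinP.
  - exact: intD.
congr fine.
(* The preimage of the sphere contains the square, and the part outside the square is null for
   [nu]. *)
rewrite (@negligible_integral _ _ _ nu _ (~` half_open_square))//; last 3 first.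
- exact: measurableC.
- exact: intD.
- by rewrite half_open_square_measureE setICl measure0.
rewrite setDE setCK setIidr//.
by apply: eq_integral => u; rewrite inE => Hu; rewrite gf.
Qed.

Lemma net_asymptotically_uniform (b : nat) (x : forall m, 'I_(b ^ m) -> R * R) :
  (1 < b)%N -> (forall m, (1 <= m)%N -> is_net (x m)) ->
  asymptotically_uniform (fun m i => lift_map (x m i)).
Proof.
move=> b1 netx f cf; have [intf ->] := sigma2_integralE cf.
(* Continuity on the closed square, which is compact, yields the uniform oscillation bound on
   cells. *)
have cfl : {within unit_square, continuous (f \o @lift_map R)}.
  move/subspace_continuousP : cf => cf.
  apply/subspace_continuousP => u Iu V /(cf _ (lift_map_sphere Iu)).
  rewrite !nbhs_simpl/= /within/= => /(continuous_lift_map (x := u)).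
  rewrite nbhs_simpl/=; apply: filterS => v HV Iv; apply: HV.
  exact: lift_map_sphere.
apply/cvgrPdist_le => e e0.
have [M HM] := grid_cell_uniform cfl e0.
have := grid_near M b1; apply: filter_app; near=> m => -[Mk Ml].
have m1 : (1 <= m)%N by near: m; exact: nbhs_infty_ge.
have dm : (m./2 + (m - m./2) = m)%N by lia.
have [c bc cP] := net_cell_bij dm (netx _ m1).
have k0 d : (0 < b ^ d)%N by rewrite expn_gt0 ltnW.
have N : #|{: 'I_(b ^ m./2) * 'I_(b ^ (m - m./2))}| = (b ^ m)%N.
  by rewrite card_prod !card_ord -expnD dm.
have -> : \sum_(i < b ^ m) f (lift_map (x m i)) =
    \sum_t f (lift_map (x m (c t))).
  by rewrite (reindex c)//; exact: onW_bij.
have := @Rintegral_partition_dist _ _ R half_open_square_measure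
  ('I_(b ^ m./2) * 'I_(b ^ (m - m./2)))%type (@grid_cell R _ _)
  (f \o @lift_map R) (fun t => f (lift_map (x m (c t)))) half_open_square e.
rewrite N; apply => //.
- exact: measurable_grid_cell.
- exact: grid_cell_inj.
- exact: grid_cell_cover.
- move=> t; rewrite half_open_square_measureE setIidl ?grid_cellE ?N//.
  exact: grid_cell_sub.
- by move=> t u tu; have := HM _ _ Mk Ml t _ _ tu (cP t); rewrite /ball/= => /ltW.
Unshelve. all: by end_near. Qed.

End integral.
End equidistribution.

Theorem theorem2 (R : realType) (delta0 : R) (b : nat)
    (x : forall m : nat, 'I_(b ^ m) -> R * R) :
  0 < delta0 ->
  (2 <= b)%N ->
  (forall m : nat, (1 <= m)%N -> is_net (x m)) ->
  let Z : forall m : nat, 'I_(b ^ m) -> R * R * R :=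
    fun m i => lift_map (x m i) in
  [/\ forall K : R, 0 < K ->
        discrepancy (Z m) (regular_sets delta0 K) @[m --> \oo] --> 0%E,
      discrepancy (Z m) (@caps R) @[m --> \oo] --> 0%E,
      discrepancy (Z m) (@rectangles R) @[m --> \oo] --> 0%E &
      asymptotically_uniform Z].
Proof.
move=> d0 b1 netx Z; split.
- move=> K K0; apply: net_discrepancy_cvg0 => //.
  + by exists set0; exact: regular_sets0.
  + by move=> A [].
  + by move=> e e0; exact: regular_sets_boundary_cells.
- apply: net_discrepancy_cvg0 => //; first exact: caps_neq0.
  + exact: caps_sigma2_measurable.
  + exact: caps_boundary_cells.
- apply: net_discrepancy_cvg0 => //; first exact: rectangles_neq0.
  + exact: rectangles_sigma2_measurable.
  + exact: rectangles_boundary_cells.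
- exact: net_asymptotically_uniform.
Qed.
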